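(* Let $C$ be a $d$-dimensional Archimedean copula with strict generator $\psi$. If $C$ is singular with respect to $\lambda_d$, then for every $\ell\in\{1,\ldots,d-2\}$ there exists a set $\Lambda\in\mathcal{B}(\mathbb{I}^\ell)$ with $\lambda_\ell(\Lambda)=1$ such that for all $\mathbf{x}\in\Lambda$ the conditional copula $C^{\mathbf{x}}$ is singular with respect to $\lambda_{d-\ell}$.
   Context: $\mathbb{I}=[0,1]$; $\lambda_m$ is Lebesgue measure on $\mathcal{B}(\mathbb{I}^m)$. A copula is singular if the probability measure it induces is singular with respect to Lebesgue measure. Archimedean copulas: a generator is a continuous, non-increasing function $\psi:[0,\infty)\to\mathbb{I}$ with $\psi(0)=1$, $\lim_{z\to\infty}\psi(z)=0$, strictly decreasing on $[0,\inf\{z\in[0,\infty]:\psi(z)=0\}]$ (with $\psi(\infty):=0$). $\varphi:(0,1]\to[0,\infty)$ denotes the pseudoinverse of $\psi$, and $\varphi(0):=\inf\{z\in[0,\infty]:\psi(z)=0\}\in(0,\infty]$. A $d$-dimensional copula $C$ is Archimedean with generator $\psi$ if $C(\mathbf{x})=\psi(\varphi(x_1)+\cdots+\varphi(x_d))$ for all $\mathbf{x}\in\mathbb{I}^d$; $C$ (and $\psi$) is strict if $\varphi(0)=\infty$. The right-hand side is a copula if and only if $\psi$ is $d$-monotone: $\psi$ is continuous on $[0,\infty)$, has derivatives $\psi^{(m)}$ up to order $d-2$ on $(0,\infty)$ with $(-1)^m\psi^{(m)}\ge0$ for $m=0,\ldots,d-2$, and $(-1)^{d-2}\psi^{(d-2)}$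 is non-increasing and convex on $(0,\infty)$. Generators are normalized so that $\psi(1)=\frac12$. Conditional copula (defined for $\mathbf{x}\in(0,1)^\ell$, so $\Lambda$ is understood as a subset of $(0,1)^\ell$): let $C$ be strict with generator $\psi$, $\ell\in\{1,\ldots,d-2\}$. The $\ell$-Markov kernel of $C$ (regular conditional distribution of the last $d-\ell$ coordinates given the first $\ell$) is taken in the version $$K_C(\mathbf{x},[\mathbf{0},\mathbf{y}])=\frac{\psi^{(\ell)}\left(\sum_{i=1}^\ell\varphi(x_i)+\sum_{j=1}^{d-\ell}\varphi(y_j)\right)}{\psi^{(\ell)}\left(\sum_{i=1}^\ell\varphi(x_i)\right)},\qquad \mathbf{y}\in\mathbb{I}^{d-\ell},$$ with $\psi^{(\ell)}(\infty):=0$. Its univariate marginal distribution functions all equal $g_{\mathbf{x}}(y)=\psi^{(\ell)}\left(\sum_{i=1}^\ell\varphi(x_i)+\varphi(y)\right)/\psi^{(\ell)}\left(\sum_{i=1}^\ell\varphi(x_i)\right)$, which is an increasing bijection of $\mathbb{I}$ with inverse $g_{\mathbf{x}}^{-1}$. The conditional copula $C^{\mathbf{x}}$ is the copula of $K_C(\mathbf{x},\cdot)$, i.e. $$C^{\mathbf{x}}(\mathbf{u})=K_C(\mathbf{x},[0,g_{\mathbf{x}}^{-1}(u_1)]\times\cdots\times[0,g_{\mathbf{x}}^{-1}(u_{d-\ell})]),\qquad\mathbf{u}\in\mathbb{I}^{d-\ell}.$$ *)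

(* Defs.v *)
From HB Require Import structures.
From mathcomp Require Import all_boot all_order all_algebra.
From mathcomp Require Import all_classical all_reals all_analysis.
Set Implicit Arguments.
Unset Strict Implicit.
Unset Printing Implicit Defensive.
Import Order.TTheory GRing.Theory Num.Theory.
Import numFieldNormedType.Exports.

Local Open Scope classical_set_scope.
Local Open Scope ring_scope.

(* n-dimensional Lebesgue measure on n.-tuple R (whose canonical sigma-algebra
   is the product one, i.e. the Borel sets of R^n), as an iterated product. *)
Section lebesgue_cons.
Context (R : realType) (n : nat).
Variable mu : {sigma_finite_measure set (n.-tuple R) -> \bar R}.

Let cons (p : measurableTypeR R * n.-tuple R) : n.+1.-tuple R :=
  [the n.+1.-tuple _ of p.1 :: p.2].

Let measurable_fun_cons : measurable_fun setT cons.
Proof. exact: (measurable_cons measurable_fst measurable_snd). Qed.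

Definition lebesgue_cons : set (n.+1.-tuple R) -> \bar R :=
  pushforward (lebesgue_measure \x mu)%E cons.

Let lebesgue_cons0 : lebesgue_cons set0 = 0%E.
Proof. by rewrite /lebesgue_cons /pushforward preimage_set0 measure0. Qed.

Let lebesgue_cons_ge0 A : (0 <= lebesgue_cons A)%E.
Proof. exact: measure_ge0. Qed.

Let measurable_preimage_cons A : measurable A -> measurable (cons @^-1` A).
Proof.
by move=> mA; rewrite -[X in measurable X]setTI; exact: measurable_fun_cons.
Qed.

Let lebesgue_cons_sigma_additive : semi_sigma_additive lebesgue_cons.
Proof.
move=> F mF tF mUF; rewrite /lebesgue_cons /pushforward preimage_bigcup.
apply: measure_semi_sigma_additive.
- by move=> k; exact: measurable_preimage_cons.
- apply/trivIsetP => i j _ _ ij; rewrite -preimage_setI.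
  by move/trivIsetP : tF => /(_ _ _ _ _ ij) ->//; rewrite preimage_set0.
- by rewrite -preimage_bigcup; exact: measurable_preimage_cons.
Qed.

HB.instance Definition _ := isMeasure.Build _ _ _ lebesgue_cons
  lebesgue_cons0 lebesgue_cons_ge0 lebesgue_cons_sigma_additive.

Let sigma_finite_lebesgue_cons : sigma_finite setT lebesgue_cons.
Proof.
have /sigma_finiteP[F [TF ndF Foo]] := sigma_finiteT (@lebesgue_measure R).
have /sigma_finiteP[G [TG ndG Goo]] := sigma_finiteT mu.
pose uncons (t : n.+1.-tuple R) : (measurableTypeR R * n.-tuple R)%type :=
  (thead t, [tuple of behead t]).
have consK p : uncons (cons p) = p.
  by case: p => x t; rewrite /uncons/= theadE; congr pair; exact/val_inj.
have uncons_measurable : measurable_fun setT uncons.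
  apply/measurable_fun_pair => /=; last exact: measurable_behead.
  exact: (@measurable_tnth _ R).
exists (fun k => uncons @^-1` (F k `*` G k)) => [|k].
  apply/esym/seteqP; split=> // t _.
  have [i _ Fi] : (\bigcup_i F i) (uncons t).1 by rewrite -TF.
  have [j _ Gj] : (\bigcup_i G i) (uncons t).2 by rewrite -TG.
  exists (maxn i j) => //; split.
  - by move: Fi; exact/subsetPset/ndF/leq_maxl.
  - by move: Gj; exact/subsetPset/ndG/leq_maxr.
have [mF Fk] := Foo k; have [mG Gk] := Goo k; split.
  rewrite -[X in measurable X]setTI.
  by apply: uncons_measurable => //; exact: measurableX.
rewrite /lebesgue_cons /pushforward.
have -> : cons @^-1` (uncons @^-1` (F k `*` G k)) = F k `*` G k.
  by apply/seteqP; split => p; rewrite /preimage; cbn [mkset]; rewrite consK.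
by rewrite product_measure1E// lte_mul_pinfty// ge0_fin_numE.
Qed.

HB.instance Definition _ := @Measure_isSigmaFinite.Build _ _ _ lebesgue_cons
  sigma_finite_lebesgue_cons.

End lebesgue_cons.

Fixpoint lebesgue_tuple (R : realType) (n : nat) :
    {sigma_finite_measure set (n.-tuple R) -> \bar R} :=
  if n is m.+1 then lebesgue_cons (lebesgue_tuple R m) else \d_([tuple]).

Lemma lebesgue_tuple_box (R : realType) (n : nat) (A : 'I_n -> set R) :
  (forall i, measurable (A i)) ->
  lebesgue_tuple R n [set t | forall i, A i (tnth t i)] =
  (\prod_(i < n) (@lebesgue_measure R) (A i))%E.
Proof.
elim: n A => [|n IH] A mA.
  by rewrite big_ord0 /= diracE mem_set// => -[].
have mbox : measurable
    [set t : n.-tuple R | forall i, A (lift ord0 i) (tnth t i)].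
  rewrite (_ : mkset _ = \bigcap_(i in [set: 'I_n])
      (fun t : n.-tuple R => tnth t i) @^-1` A (lift ord0 i)).
    apply: fin_bigcap_measurable => // i _.
    by rewrite -[X in measurable X]setTI; exact: measurable_tnth.
  by apply/seteqP; split => t h i; [move=> _|]; exact: h.
rewrite big_ord_recl -(IH (A \o lift ord0)); last by move=> i; exact: mA.
rewrite -product_measure1E//; last exact: mA.
rewrite /= /lebesgue_cons /pushforward; congr product_measure1.
apply/seteqP; split => -[x t] /=.
  move=> h; split; first by have := h ord0; rewrite tnth0.
  by move=> i; have := h (lift ord0 i); rewrite tnthS.
move=> [Ax At] i; case: (unliftP ord0 i) => [j ->|->].
  by rewrite tnthS; exact: At.
by rewrite tnth0.
Qed.

Definition mutually_singular (R : realType) d (T : measurableType d)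
    (mu nu : {measure set T -> \bar R}) : Prop :=
  exists N : set T, [/\ measurable N, mu (~` N) = 0%E & nu N = 0%E].

Section copula.
Context (R : realType).
Implicit Types (n : nat) (psi : R -> R).

Definition unit_cube n : set (n.-tuple R) :=
  [set x | forall i, 0 <= tnth x i <= 1].

Definition open_unit_cube n : set (n.-tuple R) :=
  [set x | forall i, 0 < tnth x i < 1].

Definition lower_box n (x : n.-tuple R) : set (n.-tuple R) :=
  [set t | forall i, 0 <= tnth t i <= tnth x i].

(* P is a probability measure on I^n with uniform univariate marginals and C is
   its distribution function on I^n; P is then the measure induced by C, and C
   determines it uniquely. *)
Definition copula_measure n (C : n.-tuple R -> R)
    (P : probability (n.-tuple R) R) : Prop :=
  [/\ P (@unit_cube n) = 1%E,
      forall (i : 'I_n) (u : R), 0 <= u <= 1 ->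
        P [set t | tnth t i <= u] = u%:E
    & forall x, unit_cube x -> P (lower_box x) = (C x)%:E].

(* Only the values of C on I^n matter. *)
Definition copula n (C : n.-tuple R -> R) : Prop :=
  exists P, copula_measure C P.

(* The induced measure lives on I^n, so singularity with respect to Lebesgue
   measure on R^n is the same as with respect to its restriction to I^n. *)
Definition singular_copula n (C : n.-tuple R -> R) : Prop :=
  exists2 P, copula_measure C P & mutually_singular P (lebesgue_tuple R n).

(* f extended to [0, oo] by f(oo) := 0; the value at -oo is never used. *)
Definition ext0 (f : R -> R) (z : \bar R) : R :=
  if z is s%:E then f s else 0.

(* The pseudoinverse phi of psi: for x in (0, 1] the least z with psi(z) = x,
   and phi(0) = inf {z in [0, oo] : psi(z) = 0}, possibly +oo. *)
Definition pseudoinverse psi (x : R) : \bar R :=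
  ereal_inf [set z | (0 <= z)%E /\ ext0 psi z = x].

(* Only the values of psi on [0, oo) matter; psi 1 = 1/2 is the usual
   normalization. *)
Definition generator psi : Prop :=
  [/\ {within `[0, +oo[, continuous psi},
      (forall z, 0 <= z -> 0 <= psi z <= 1) /\
        (forall s t, 0 <= s -> s <= t -> psi t <= psi s),
      psi 0 = 1 /\ psi z @[z --> +oo] --> 0,
      (forall s t : \bar R,
        (0 <= s)%E -> (s < t)%E -> (t <= pseudoinverse psi 0)%E ->
        ext0 psi t < ext0 psi s)
    & psi 1 = 2^-1].

Definition strict psi : Prop := pseudoinverse psi 0 = +oo%E.

Definition archimedean n (C : n.-tuple R -> R) psi : Prop :=
  [/\ copula C, generator psi
    & forall x, unit_cube x ->
        C x = ext0 psi (\sum_(i < n) pseudoinverse psi (tnth x i))%E].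

(* K_C(x, [0, y]) for x of length l and y of length k = d - l *)
Definition markov_kernel psi l (x : l.-tuple R) k (y : k.-tuple R) : R :=
  let s := (\sum_(i < l) pseudoinverse psi (tnth x i))%E in
  ext0 (derive1n l psi) (s + \sum_(j < k) pseudoinverse psi (tnth y j))%E /
  ext0 (derive1n l psi) s.

(* g_x, the common univariate marginal distribution function of K_C(x, .) *)
Definition kernel_marginal psi l (x : l.-tuple R) (y : R) : R :=
  let s := (\sum_(i < l) pseudoinverse psi (tnth x i))%E in
  ext0 (derive1n l psi) (s + pseudoinverse psi y)%E / ext0 (derive1n l psi) s.

(* The inverse of g_x as a map from I to I. *)
Definition kernel_quantile psi l (x : l.-tuple R) : R -> R :=
  'pinv_(fun=> 0) `[0, 1] (kernel_marginal psi x).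

Definition conditional_copula psi l (x : l.-tuple R) k (u : k.-tuple R) : R :=
  markov_kernel psi x (map_tuple (kernel_quantile psi x) u).

End copula.

(* Main.v *)
From HB Require Import structures.
Require Import Defs.
From mathcomp Require Import all_boot all_order all_algebra.
From mathcomp Require Import all_classical all_reals all_analysis.
From mathcomp Require Import measurable_realfun zify ring lra.
Set Implicit Arguments.
Unset Strict Implicit.
Unset Printing Implicit Defensive.
Import Order.TTheory GRing.Theory Num.Theory.
Import numFieldNormedType.Exports.
Local Open Scope classical_set_scope.
Local Open Scope ring_scope.

(** Write T = (phi(X_1), ..., phi(X_d)) for a vector X distributed according to
    C, and d = n + 1. For a >= 0 one has P(T_1 >= a_1, ..., T_d >= a_d) =
    psi(a_1 + ... + a_d), which depends on the sum of the a_i only. Hence the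
    law of T is invariant under the translations by vectors of zero sum, as far
    as these stay in the orthant ([orthant_shift_invariant]). By the Fubini
    argument that proves the uniqueness of Haar measure, such a law is spread
    uniformly over each simplex {t >= 0, t_1 + ... + t_d = r}: up to a constant
    it is gamma(dr) times the Lebesgue measure of this simplex, where gamma is
    obtained from the law of the sum ([radial_decomposition]). Three facts
    follow, and they give the theorem.

    - On (s0, oo), with s0 > 0 as small as desired, psi is a constant multiple
      of the Williamson transform J_n, where
      J_j(z) = int V_j(r - z) gamma(dr) and V_j is the volume of a simplex of
      dimension j. Comparing V_{j+1}(rho) with V_{j+1}(rho - h) gives
      h J_j(z + h) <= J_{j+1}(z) - J_{j+1}(z + h) <= h J_j(z),
      so that J_{j+1}' = - J_j wherever J_j is continuous. This yields the
      derivatives of psi up to order d - 2 together with their signs, their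
      monotonicity and their local Lipschitz bounds ([derive1n_williamsonr]).

    - If C is carried by a Lebesgue null set N, then gamma is carried by a
      Lebesgue null set M above s0 ([radial_law_singular]). Indeed psi
      expands distances by a positive factor on each compact subset of (0, oo),
      so N becomes a null set in the coordinates T. For gamma-almost every r it
      fills almost all of the simplex of radius r, while for Lebesgue-almost
      every r it meets this simplex in a null set; since simplices have positive
      measure, both cannot happen for the same r.

    - Given the first l coordinates, with s = phi(x_1) + ... + phi(x_l) > s0,
      the others have the law gamma(dr) times Lebesgue measure on the simplex of
      radius r - s, up to normalization. Let m + 1 = d - l. Mapping these
      coordinates by F(y) = J_m(s + y) / J_m(s) gives a law with uniform
      margins and with the distribution function of the conditional copula
      ([conditional_law_box], [conditional_copulaE]). It is carried by the u
      with s + F^-1(u_1) + ... + F^-1(u_{m+1}) in M, and this is a null set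
      since F is Lipschitz ([conditional_law_singular]).

    The set Lambda is the whole open cube. *)

(** * Tuples and uniqueness of measures on them *)

Section tuples.
Context {R : realType}.
Implicit Types n : nat.

Definition tcons n (a : R) (t : n.-tuple R) : n.+1.-tuple R :=
  [the n.+1.-tuple R of a :: t].

Definition tsum n (t : n.-tuple R) : R := \sum_(i < n) tnth t i.

Definition tadd n (t v : n.-tuple R) : n.-tuple R :=
  [tuple tnth t i + tnth v i | i < n].

Definition upper_box n (a : 'I_n -> R) : set (n.-tuple R) :=
  [set t | forall i, a i <= tnth t i].

Lemma tnth_tadd n (t v : n.-tuple R) i :
  tnth (tadd t v) i = tnth t i + tnth v i.
Proof. by rewrite tnth_mktuple. Qed.

Lemma tsum_cons n a (t : n.-tuple R) : tsum (tcons a t) = a + tsum t.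
Proof.
rewrite /tsum big_ord_recl tnth0; congr (_ + _).
by apply: eq_bigr => i _; rewrite tnthS.
Qed.

Lemma tsum_tadd n (t v : n.-tuple R) : tsum (tadd t v) = tsum t + tsum v.
Proof. by rewrite /tsum -big_split; apply: eq_bigr => i _; rewrite tnth_tadd. Qed.

Lemma tadd_cons n a b (t v : n.-tuple R) :
  tadd (tcons a t) (tcons b v) = tcons (a + b) (tadd t v).
Proof.
apply: eq_from_tnth => i; rewrite tnth_tadd.
by case: (unliftP ord0 i) => [j ->|->]; rewrite ?tnthS ?tnth0 // tnth_tadd.
Qed.

Definition ttail n (t : n.+1.-tuple R) : n.-tuple R := [tuple of behead t].

Lemma tcons_eta n (t : n.+1.-tuple R) : tcons (thead t) (ttail t) = t.
Proof. by rewrite [RHS]tuple_eta. Qed.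

Lemma thead_tcons n a (t : n.-tuple R) : thead (tcons a t) = a.
Proof. by []. Qed.

Lemma ttail_tcons n a (t : n.-tuple R) : ttail (tcons a t) = t.
Proof. exact: val_inj. Qed.

Lemma tnth_ttail n (t : n.+1.-tuple R) i :
  tnth (ttail t) i = tnth t (lift ord0 i).
Proof. by rewrite -{2}(tcons_eta t) tnthS. Qed.

Lemma forall_tcons n a (t : n.-tuple R) (Q : 'I_n.+1 -> R -> Prop) :
  (forall i, Q i (tnth (tcons a t) i)) <->
  Q ord0 a /\ forall i, Q (lift ord0 i) (tnth t i).
Proof.
split=> [h|[h0 h] i]; first split=> [|i].
- by have := h ord0; rewrite tnth0.
- by have := h (lift ord0 i); rewrite tnthS.
- by case: (unliftP ord0 i) => [j ->|->]; rewrite ?tnthS ?tnth0.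
Qed.

Lemma measurable_forall_tnth n (A : 'I_n -> set R) :
  (forall i, measurable (A i)) ->
  measurable [set t : n.-tuple R | forall i, A i (tnth t i)].
Proof.
move=> mA; rewrite (_ : mkset _ = \bigcap_(i in [set: 'I_n])
    (fun t : n.-tuple R => tnth t i) @^-1` A i).
  apply: fin_bigcap_measurable => // i _.
  by rewrite -[X in measurable X]setTI; exact: measurable_tnth.
by apply/seteqP; split => t h i; [move=> _|]; exact: h.
Qed.

Lemma measurable_upper_box n (a : 'I_n -> R) : measurable (upper_box a).
Proof.
rewrite (_ : upper_box a = [set t | forall i, `[a i, +oo[%classic (tnth t i)]).
  apply: (measurable_forall_tnth (A := fun i => `[a i, +oo[%classic)) => i.
  exact: measurable_itv.
by apply/seteqP; split => t h i; have := h i; rewrite /= in_itv/= andbT.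
Qed.

Lemma measurable_fun_tcons d (T : measurableType d) n (f : T -> R)
    (g : T -> n.-tuple R) : measurable_fun setT f -> measurable_fun setT g ->
  measurable_fun setT (fun x => tcons (f x) (g x)).
Proof. exact: measurable_cons. Qed.

Lemma measurable_fun_tnth d (T : measurableType d) n (g : T -> n.-tuple R) i :
  measurable_fun setT g -> measurable_fun setT (fun x => tnth (g x) i).
Proof.
move=> mg; apply: (@measurableT_comp _ _ _ _ _ _ (fun t => tnth t i)) => //.
exact: measurable_tnth.
Qed.

Lemma measurable_fun_tsum d (T : measurableType d) n (g : T -> n.-tuple R) :
  measurable_fun setT g -> measurable_fun setT (fun x => tsum (g x)).
Proof.
move=> mg; rewrite /tsum; 
  apply: (@measurable_sum _ _ _ _ _ _ (fun i x => tnth (g x) i)) => i.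
exact: measurable_fun_tnth.
Qed.

Lemma measurable_fun_tadd d (T : measurableType d) n (f g : T -> n.-tuple R) :
  measurable_fun setT f -> measurable_fun setT g ->
  measurable_fun setT (fun x => tadd (f x) (g x)).
Proof.
move=> mf mg; apply/measurable_fun_tnthP => i.
rewrite (_ : _ \o _ = fun x => tnth (f x) i + tnth (g x) i).
  by apply: measurable_funD; exact: measurable_fun_tnth.
by apply/funext => x /=; rewrite tnth_tadd.
Qed.

Lemma measurable_fun_map_tuple n (h : R -> R) : measurable_fun setT h ->
  measurable_fun setT (map_tuple h : n.-tuple R -> n.-tuple R).
Proof.
move=> mh; apply/measurable_fun_tnthP => i.
rewrite (_ : _ \o _ = fun x => h (tnth x i)).
  by apply: measurableT_comp => //; exact: measurable_tnth.
by apply/funext => x /=; rewrite tnth_map.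
Qed.

End tuples.

Section uniqueness.
Context {R : realType} (n : nat).

(** Upper boxes are stable under intersection and generate the Borel sets. *)
Lemma upper_box_measure_unique
    (m1 m2 : {measure set (n.-tuple R) -> \bar R}) :
  (m1 setT < +oo)%E ->
  (forall a, m1 (upper_box a) = m2 (upper_box a)) ->
  forall A, measurable A -> m1 A = m2 A.
Proof.
move=> m1T m12 A mA.
pose G : set (set (n.-tuple R)) := range (@upper_box R n).
pose g (k : nat) : set (n.-tuple R) := upper_box (fun=> - k%:R).
have mG : @measurable _ (n.-tuple R) = <<s G >>.
  apply/seteqP; split; last first.
    apply: smallest_sub; first exact: sigma_algebra_measurable.
    by move=> _ [a _ <-]; exact: measurable_upper_box.
  (* a half-line condition on one coordinate is a countable union of boxes *)
  apply: smallest_sub; first exact: smallest_sigma_algebra.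
  case: n @G @g {m1 m2 m1T m12 A mA} => [|k] G g.
    by rewrite big_ord0.
  rewrite -bigcup_mkord_ord => B [i _]; move: (inord i) => {}i.
  rewrite /preimage_set_system /= => -[C mC <-]; rewrite setTI.
  suff : measurable_fun setT
      ((fun t => tnth t i) : g_sigma_algebraType G -> R).
    by move=> /(_ measurableT C mC); rewrite setTI.
  apply: (@measurability _ _ _ _ _ _ (@RGenCInfty.G R)).
    exact: RGenCInfty.measurableE.
  move=> _ [_ [r ->] <-]; rewrite setTI.
  rewrite (_ : _ @^-1` _ = \bigcup_m
    upper_box (fun j => if j == i then r else - m%:R)); last first.
    apply/seteqP; split => t /=; last first.
      by case=> m _ /(_ i); rewrite eqxx in_itv/= andbT.
    rewrite in_itv/= andbT => ri.
    exists (Num.bound (\sum_j `|tnth t j|)) => // j.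
    case: eqP => [->//|_]; rewrite lerNl.
    apply: le_trans (ltW (archi_boundP _)); last exact: sumr_ge0.
    rewrite (le_trans (ler_norm _))// normrN (bigD1 j)//= lerDl.
    exact: sumr_ge0.
  by apply: bigcup_measurable => m _; apply: sub_sigma_algebra; exists (fun
    j => if j == i then r else - m%:R).
apply: (measure_unique G g) => //.
- move=> _ _ [a _ <-] [b _ <-]; exists (fun i => Num.max (a i) (b i)) => //.
  apply/seteqP; split => t /=.
    by move=> h; split => i; have := h i; rewrite ge_max => /andP[].
  by move=> [h1 h2] i; rewrite ge_max h1 h2.
- by move=> i; eexists.
- apply/seteqP; split => // t _.
  exists (Num.bound (\sum_j `|tnth t j|)) => // j; rewrite lerNl.
  apply: le_trans (ltW (archi_boundP _)); last exact: sumr_ge0.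
  rewrite (le_trans (ler_norm _))// normrN (bigD1 j)//= lerDl.
  exact: sumr_ge0.
- by move=> _ [a _ <-]; exact: m12.
- move=> k; apply: le_lt_trans m1T; apply: le_measure; rewrite ?inE//.
  exact: measurable_upper_box.
Qed.

End uniqueness.

(** * Sections, translations and null sets of Lebesgue measure *)

Section sections_of_products.
Local Open Scope ereal_scope.
Context d1 d2 (T1 : measurableType d1) (T2 : measurableType d2) {R : realType}.
Variable m1 : {sigma_finite_measure set T1 -> \bar R}.
Variable m2 : {sigma_finite_measure set T2 -> \bar R}.
Implicit Type S : set (T1 * T2).

Lemma product_sectionsl S :
  (m1 \x m2) S = \int[m1]_x m2 [set y | S (x, y)].
Proof. by apply: eq_integral => x _ /=; rewrite xsectionE. Qed.

(** Tonelli for indicator functions. *)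
Lemma product_sectionsr S : measurable S ->
  (m1 \x m2) S = \int[m2]_y m1 [set x | S (x, y)].
Proof.
move=> mS; rewrite (product_measure_unique (m' := m1 \x^ m2))//; last first.
  exact: product_measure2E.
by apply: eq_integral => y _ /=; rewrite ysectionE.
Qed.

Lemma measurable_sectionl S : measurable S ->
  measurable_fun setT (fun x => m2 [set y | S (x, y)]).
Proof.
move=> mS; have := measurable_fun_xsection m2 mS.
by congr (measurable_fun _); apply/funext => x /=; rewrite xsectionE.
Qed.

Lemma measurable_sectionr S : measurable S ->
  measurable_fun setT (fun y => m1 [set x | S (x, y)]).
Proof.
move=> mS; have := measurable_fun_ysection m1 mS.
by congr (measurable_fun _); apply/funext => x /=; rewrite ysectionE.
Qed.

End sections_of_products.

Section lebesgue.
Context {R : realType}.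
Notation lam := (@lebesgue_measure R).
Notation lamt := (lebesgue_tuple R).

Lemma measurable_preimageT d1 d2 (T1 : measurableType d1)
    (T2 : measurableType d2) (f : T1 -> T2) (A : set T2) :
  measurable_fun setT f -> measurable A -> measurable [set x | A (f x)].
Proof. by move=> mf mA; rewrite -[X in measurable X]setTI; exact: mf. Qed.

Lemma lebesgue_tupleSl n (A : set (n.+1.-tuple R)) :
  (lamt n.+1 A = \int[lam]_a lamt n [set t | A (tcons a t)])%E.
Proof. exact: (product_sectionsl lam (lamt n) [set p | A (tcons p.1 p.2)]). Qed.

Lemma measurable_tcons_preimage n (A : set (n.+1.-tuple R)) : measurable A ->
  measurable [set p : measurableTypeR R * n.-tuple R | A (tcons p.1 p.2)].
Proof.
by move=> mA; apply: measurable_preimageT => //; exact: measurable_fun_tcons.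
Qed.

Lemma measurable_tcons_head n (t : n.-tuple R) (A : set (n.+1.-tuple R)) :
  measurable A -> measurable [set a | A (tcons a t)].
Proof.
apply: (measurable_preimageT (f := fun a => tcons a t)).
by apply: (measurable_fun_tcons (f := id) (g := fun=> t)).
Qed.

Lemma measurable_tcons_tail n (a : R) (A : set (n.+1.-tuple R)) :
  measurable A -> measurable [set t | A (tcons a t)].
Proof.
apply: (measurable_preimageT (f := fun t => tcons a t)).
by apply: (measurable_fun_tcons (f := fun=> a) (g := id)).
Qed.

Lemma measurable_tadd_preimage n (v : n.-tuple R) (A : set (n.-tuple R)) :
  measurable A -> measurable [set t | A (tadd v t)].
Proof.
apply: (measurable_preimageT (f := tadd v)).
by apply: (measurable_fun_tadd (f := fun=> v) (g := id)).
Qed.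

Lemma lebesgue_tupleSr n (A : set (n.+1.-tuple R)) : measurable A ->
  (lamt n.+1 A = \int[lamt n]_t lam [set a | A (tcons a t)])%E.
Proof.
move=> mA.
exact: (product_sectionsr lam (lamt n) (measurable_tcons_preimage mA)).
Qed.

Lemma lebesgue_measure_translate (c : R) (A : set R) : measurable A ->
  lam [set x | A (c + x)] = lam A.
Proof.
move=> mA; pose f : R -> measurableTypeR R := fun x => c + x.
have mf : measurable_fun setT f by exact: measurable_funD.
suff : pushforward lam f A = lam A by [].
apply/esym/lebesgue_measure_unique => //= _ [[a b]] _ <-.
rewrite /pushforward (_ : f @^-1` _ = `](a - c), (b - c)]%classic); last first.
  by apply/seteqP; split => x; rewrite /preimage/= /f !in_itv/= ltrBlDl lerBrDl.
rewrite [LHS]lebesgue_measure_itv [RHS]lebesgue_measure_itv/= !lte_fin ltrD2r.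
by case: ifPn => // _; congr (_%:E); lra.
Qed.

Lemma lebesgue_tuple0 (A : set (0.-tuple R)) :
  lamt 0 A = \d_([tuple] : 0.-tuple R) A.
Proof. by []. Qed.

Lemma lebesgue_tuple_translate n (v : n.-tuple R) (A : set (n.-tuple R)) :
  measurable A -> lamt n [set t | A (tadd v t)] = lamt n A.
Proof.
elim: n v A => [|n IH] v A mA.
  congr (lebesgue_tuple R 0 _); apply/seteqP; split => t /=;
    by rewrite (tuple0 t) (tuple0 (tadd _ _)).
have -> : v = tcons (thead v) (ttail v) by rewrite tcons_eta.
move: (thead v) (ttail v) => {v} c v.
pose B := [set t : n.+1.-tuple R | A (tadd (tcons 0 v) t)].
have mB : measurable B.
  exact: measurable_tadd_preimage.
transitivity (lamt n.+1 B).
  rewrite lebesgue_tupleSr; last exact: measurable_tadd_preimage.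
  rewrite lebesgue_tupleSr//; apply: eq_integral => t _.
  rewrite -[RHS](lebesgue_measure_translate c); last exact: measurable_tcons_head.
  congr (lam _); apply/seteqP; split => x /=; rewrite /B/=;
    by rewrite !tadd_cons add0r.
rewrite !lebesgue_tupleSl; apply: eq_integral => a _.
rewrite -[RHS](IH v); last exact: measurable_tcons_tail.
congr (lamt n _); apply/seteqP; split => t /=; rewrite /B/=;
  by rewrite tadd_cons add0r.
Qed.

(** A cover of [N] by intervals pulls back to a cover of its preimage by sets
    whose diameters are at most [c^-1] times larger. *)
Lemma lebesgue_measure0_expanding (h : R -> R) (I N : set R) (c : R) :
  0 < c -> measurable_fun setT h -> measurable I -> measurable N ->
  (forall a b, I a -> I b -> c * `|a - b| <= `|h a - h b|) ->
  lam N = 0%E -> lam (I `&` h @^-1` N) = 0%E.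
Proof.
move=> c0 mh mI mN hI N0.
have mhA A : measurable A -> measurable (I `&` h @^-1` A).
  by move=> mA; apply: measurableI => //; exact: measurable_preimageT.
apply/eqP; rewrite eq_le measure_ge0 andbT; apply/lee_addgt0Pr => e e0.
rewrite add0e.
have Nneg : lam.-negligible N by exists N; split.
move: (proj1 (negligible_outer_measure _) Nneg).
rewrite outer_measure_open_itv_cover => Ninf.
have ec0 : 0 < e * c / 2 by rewrite divr_gt0// mulr_gt0.
have : ereal_inf [set (\sum_(0 <= k <oo) wlength idfun (I_ k))%E
    | I_ in open_itv_cover N] \is a fin_num by rewrite Ninf.
move=> /lb_ereal_inf_adherent -/(_ _ ec0)[_ [F [Fitv NF] <-]].
rewrite Ninf add0e => /ltW Fe.
have mF k : measurable (F k).
  by have [ab ->] := Fitv k; exact: measurable_itv.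
apply: (@le_trans _ _ (\sum_(0 <= k <oo) lam (I `&` h @^-1` F k))%E).
  apply: measure_sigma_subadditive => //; [by move=> k; exact: mhA|exact: mhA|].
  by move=> x [Ix /NF[k _ Fk]]; exists k.
apply: (@le_trans _ _ (\sum_(0 <= k <oo)
    (2 / c)%:E * wlength idfun (F k))%E); last first.
  rewrite nneseriesZl//.
  apply: (@le_trans _ _ ((2 / c)%:E * (e * c / 2)%:E)%E).
    by apply: lee_wpmul2l => //; rewrite lee_fin divr_ge0// ltW.
  rewrite -EFinM lee_fin le_eqVlt; apply/orP; left; apply/eqP; field.
  by rewrite gt_eqF.
apply: lee_nneseries => // k _.
have [[a b] Fk] := Fitv k; rewrite Fk.
have [->|/set0P[p [Ip Fp]]] := eqVneq (I `&` h @^-1` `]a, b[%classic) set0.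
  by rewrite measure0 mule_ge0// lee_fin divr_ge0// ltW.
have ab : a < b by move: Fp; rewrite /= in_itv/= => /andP[]; exact: lt_trans.
rewrite wlength_itv_bnd ?(ltW ab)//= -EFinM.
pose r := (b - a) / c.
apply: (@le_trans _ _ (lam `[p - r, p + r]%classic)).
  apply: le_measure; rewrite ?inE; [exact: mhA|exact: measurable_itv|].
  move=> x [Ix]; move: Fp; rewrite /= !in_itv/= => /andP[p1 p2] /andP[x1 x2].
  have : `|x - p| <= r.
    rewrite /r ler_pdivlMr// mulrC (le_trans (hI _ _ Ix Ip))//.
    by rewrite ler_norml; apply/andP; split; lra.
  by rewrite ler_norml => /andP[? ?]; apply/andP; split; lra.
rewrite lebesgue_measure_itv/= lte_fin; case: ifPn => _; rewrite lee_fin.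
  by rewrite /r le_eqVlt; apply/orP; left; apply/eqP; field; rewrite gt_eqF.
by rewrite mulr_ge0 ?divr_ge0// ?subr_ge0 ltW.
Qed.

End lebesgue.

Lemma measurable_neq0 d (T : measurableType d) (R : realType)
    (f : T -> \bar R) :
  measurable_fun setT f -> measurable [set x | f x != 0%E].
Proof.
by move=> mf; rewrite -[X in measurable X]setTI; exact: emeasurable_neq.
Qed.

Lemma ge0_integral_eq0P d (T : measurableType d) (R : realType)
    (mu : {measure set T -> \bar R}) (f : T -> \bar R) :
  measurable_fun setT f -> (forall x, 0 <= f x)%E ->
  (\int[mu]_x f x = 0)%E <-> mu [set x | f x != 0%E] = 0%E.
Proof.
move=> mf f0.
have mf0 : measurable [set x | f x != 0%E].
  exact: measurable_neq0.
have <- : (\int[mu]_x `|f x| = \int[mu]_x f x)%E.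
  by apply: eq_integral => x _; rewrite gee0_abs.
split=> [/(ae_eq_integral_abs mu measurableT mf) fae|/negligibleP fneg].
  apply/negligibleP => //; apply: negligibleS fae => x /= /eqP fx.
  by apply: contra_not fx; exact.
apply/(ae_eq_integral_abs mu measurableT mf).
apply: negligibleS (fneg mf0) => x /= fx.
by apply/eqP => fx0; apply: fx.
Qed.

Section null_maps.
Context {R : realType}.
Notation lam := (@lebesgue_measure R).
Notation lamt := (lebesgue_tuple R).

(** The null-set property of a map passes to its coordinatewise powers by
    Tonelli and induction: almost every section of a null set is null. *)
Lemma lebesgue_tuple0_map n (h : R -> R) (I : set R) (N : set (n.-tuple R)) :
  measurable_fun setT h -> measurable I ->
  (forall A, measurable A -> lam A = 0%E -> lam (I `&` h @^-1` A) = 0%E) ->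
  measurable N -> lamt n N = 0%E ->
  lamt n [set t | (forall i, I (tnth t i)) /\ N (map_tuple h t)] = 0%E.
Proof.
move=> mh mI hI; elim: n N => [|n IH] N mN N0.
  apply: (subset_measure0 _ mN _ N0) => //.
    apply: measurableI; last by apply: measurable_preimageT => //;
      exact: measurable_fun_map_tuple.
    exact: (measurable_forall_tnth (A := fun=> I)).
  by move=> t [_]; rewrite (tuple0 (map_tuple h t)) (tuple0 t).
have mS k (A : set (k.-tuple R)) : measurable A ->
    measurable [set t | (forall i, I (tnth t i)) /\ A (map_tuple h t)].
  move=> mA; apply: measurableI.
    exact: (measurable_forall_tnth (A := fun=> I)).
  by apply: measurable_preimageT => //; exact: measurable_fun_map_tuple.
pose N2 := [set t | lam [set a | N (tcons a t)] != 0%E].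
have mN1 : measurable_fun setT (fun t => lam [set a | N (tcons a t)]).
  exact: (measurable_sectionr lam (measurable_tcons_preimage mN)).
have mN2 : measurable N2.
  exact: measurable_neq0.
have N20 : lamt n N2 = 0%E.
  by apply/(ge0_integral_eq0P (lamt n) mN1) => //; rewrite -lebesgue_tupleSr.
rewrite lebesgue_tupleSr; last exact: mS.
apply/ge0_integral_eq0P => //.
  exact: (measurable_sectionr lam (measurable_tcons_preimage (mS _ _ mN))).
have mN3 := mS _ _ mN2.
apply: (subset_measure0 _ mN3 _ (IH _ mN2 N20)) => //.
  apply: measurable_neq0.
  exact: (measurable_sectionr lam (measurable_tcons_preimage (mS _ _ mN))).
move=> t /eqP; apply: contra_notP => /not_andP nt.
pose S := [set a | N (tcons a (map_tuple h t))].
have mSh : measurable S by exact: measurable_tcons_head.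
have mIS : measurable (I `&` h @^-1` S).
  by apply: measurableI => //; exact: measurable_preimageT.
have [It|It] := pselect (forall i, I (tnth t i)); last first.
  rewrite -[RHS](@measure0 _ _ _ lam); congr (lam _).
  apply/seteqP; split => a //= [/(forall_tcons _ _ (fun=> I))[_ ?] _].
  exact: It.
have S0 : lam S = 0%E.
  by case: nt => // /negP; rewrite negbK => /eqP.
apply: (@subset_measure0 _ _ _ lam _ (I `&` h @^-1` S)) => //; last exact: hI.
  exact: (measurable_tcons_head t (mS _ _ mN)).
move=> a /= [/(forall_tcons _ _ (fun=> I))[Ia _]]; rewrite /S/= => Na; split => //=.
by congr N: Na; apply: eq_from_tnth => i; case: (unliftP ord0 i) => [j ->|->];
  rewrite tnth_map ?tnthS ?tnth0// tnth_map.
Qed.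

End null_maps.

(** * Volumes of simplices *)

Section simplex.
Context {R : realType}.
Notation lam := (@lebesgue_measure R).
Notation lamt := (lebesgue_tuple R).

Definition simplex n (rho : R) : set (n.-tuple R) :=
  [set t | (forall i, 0 <= tnth t i) /\ tsum t <= rho].
Arguments simplex n rho : clear implicits.

Lemma simplex_tcons n rho a (t : n.-tuple R) :
  simplex n.+1 rho (tcons a t) <-> 0 <= a /\ simplex n (rho - a) t.
Proof.
rewrite /simplex/= tsum_cons lerBrDl.
split=> [[/(forall_tcons _ _ (fun=> (fun x => 0 <= x)))[? ?] ?]|[? [? ?]]] //.
by split => //; apply/(forall_tcons _ _ (fun=> (fun x => 0 <= x))).
Qed.

Lemma measurable_simplex_preimage d (T : measurableType d) n
    (f : T -> R) (g : T -> n.-tuple R) :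
  measurable_fun setT f -> measurable_fun setT g ->
  measurable [set x | simplex n (f x) (g x)].
Proof.
move=> mf mg.
have m1 : measurable [set x | upper_box (fun=> 0) (g x)].
  by apply: measurable_preimageT => //; exact: measurable_upper_box.
have m2 : measurable [set x | tsum (g x) <= f x].
  rewrite -[X in measurable X]setTI.
  by apply: measurable_fun_le => //; exact: measurable_fun_tsum.
exact: measurableI.
Qed.

Lemma measurable_simplex n rho : measurable (simplex n rho).
Proof. exact: (measurable_simplex_preimage (f := fun=> rho) (g := id)). Qed.

Definition simplex_volume n (rho : R) : \bar R := lamt n (simplex n rho).

Lemma simplex_volume_ge0 n (rho : R) : (0 <= simplex_volume n rho)%E.
Proof. exact: measure_ge0. Qed.

Lemma simplex_volume_lt0 n (rho : R) : rho < 0 -> simplex_volume n rho = 0%E.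
Proof.
move=> r0; rewrite /simplex_volume (_ : simplex n rho = set0) ?measure0//.
apply/seteqP; split => // t [t0] /le_lt_trans /(_ r0).
by rewrite ltNge /tsum sumr_ge0.
Qed.

Lemma simplex_volume0 (rho : R) : 0 <= rho -> simplex_volume 0 rho = 1%E.
Proof.
move=> r0; rewrite /simplex_volume lebesgue_tuple0 diracE mem_set//.
by split=> [[]//|]; rewrite /tsum big_ord0.
Qed.

(* The part of a simplex where the first coordinate is at least h is a
   translate of a smaller simplex; the rest is compared with cylinders. *)
Let slab n (h rho : R) : set (n.+1.-tuple R) :=
  [set t | 0 <= thead t < h /\ simplex n rho (ttail t)].

Let slab_volume n (h rho : R) : 0 < h ->
  lamt n.+1 (slab h rho) = (h%:E * simplex_volume n rho)%E.
Proof.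
move=> h0.
pose B : set (measurableTypeR R * n.-tuple R) :=
  `[0, h[%classic `*` simplex n rho.
transitivity ((lam \x lamt n)%E B).
  congr (product_measure1 _ _ _); apply/seteqP; split => -[a t];
  rewrite /slab /B /preimage /mkset thead_tcons ttail_tcons;
  by move=> [? ?]; split.
rewrite /B product_measure1E//; last exact: measurable_simplex.
congr (_ * _)%E; transitivity (lam `[0, h[%classic) => //.
by rewrite lebesgue_measure_itv/= lte_fin h0 oppr0 addr0.
Qed.

Let measurable_thead n (i : interval R) :
  measurable [set t : n.+1.-tuple R | thead t \in i].
Proof.
apply: (measurable_preimageT (A := [set` i])
  (f := fun t : n.+1.-tuple R => thead t)) => //.
exact: measurable_tnth.
Qed.

Let measurable_slab n (h rho : R) : measurable (@slab n h rho).
Proof.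
have m1 := @measurable_thead n `[0, h[.
suff m2 : measurable [set t : n.+1.-tuple R | simplex n rho (ttail t)].
  rewrite (_ : slab h rho = [set t | thead t \in `[0, h[] `&`
      [set t | simplex n rho (ttail t)]); first exact: measurableI.
  by apply/seteqP; split => t; rewrite /setI/= in_itv.
apply: (measurable_simplex_preimage (f := fun=> rho)) => //.
exact: measurable_behead.
Qed.

Let shifted n (h rho : R) : set (n.+1.-tuple R) :=
  [set t | h <= thead t /\ simplex n.+1 rho t].

Let measurable_shifted n (h rho : R) : measurable (@shifted n h rho).
Proof.
have m1 := @measurable_thead n `[h, +oo[.
rewrite (_ : shifted h rho = [set t | thead t \in `[h, +oo[] `&`
    simplex n.+1 rho).
  by apply: measurableI => //; exact: measurable_simplex.
by apply/seteqP; split => t; rewrite /setI/= in_itv/= andbT.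
Qed.

Let shift_volume n (h rho : R) : 0 < h ->
  lamt n.+1 (shifted h rho) = simplex_volume n.+1 (rho - h).
Proof.
move=> h0.
rewrite -(lebesgue_tuple_translate (tcons h [tuple 0 | i < n])); last first.
  exact: measurable_shifted.
congr (lebesgue_tuple R n.+1 _).
have z0 (t : n.-tuple R) : tadd [tuple 0 | i < n] t = t.
  by apply: eq_from_tnth => i; rewrite tnth_tadd tnth_mktuple add0r.
apply/seteqP; split => t; rewrite -(tcons_eta t);
  move: (thead t) (ttail t) => a {}t;
  rewrite /shifted /mkset tadd_cons z0 thead_tcons.
  move=> [ha /simplex_tcons[_ st]]; apply/simplex_tcons; split; first lra.
  by move: st; rewrite opprD addrA.
move=> /simplex_tcons[a0 st]; split; first lra.
by apply/simplex_tcons; split; [lra|rewrite opprD addrA].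
Qed.

(** V_{n+1}(rho) - V_{n+1}(rho - h) is the volume of the slab [0 <= t_0 < h]
    of the simplex, which lies between the cylinders over the simplices of size [rho - h] and
    [rho]. *)
Lemma simplex_volumeS_ge n (h rho : R) : 0 < h ->
  (h%:E * simplex_volume n (rho - h) + simplex_volume n.+1 (rho - h)
    <= simplex_volume n.+1 rho)%E.
Proof.
move=> h0; rewrite -slab_volume// -(shift_volume _ _ h0).
have ms := measurable_slab; have mt := measurable_shifted.
rewrite -measureU//.
- apply: le_measure; rewrite ?inE.
  + by apply: measurableU; [exact: ms|exact: mt].
  + exact: measurable_simplex.
  move=> t []; last by case.
  rewrite -(tcons_eta t); move: (thead t) (ttail t) => a {}t.
  rewrite /slab /mkset thead_tcons ttail_tcons => -[/andP[a0 ah] [t0 ts]].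
  by apply/simplex_tcons; split => //; split => //; lra.
- exact: ms.
- exact: mt.
- apply/seteqP; split => // t [[/andP[_ th] _] [ht _]].
  by move: th; rewrite ltNge ht.
Qed.

Lemma simplex_volumeS_le n (h rho : R) : 0 < h ->
  (simplex_volume n.+1 rho <=
    h%:E * simplex_volume n rho + simplex_volume n.+1 (rho - h))%E.
Proof.
move=> h0; rewrite -slab_volume// -(shift_volume _ _ h0).
have ms := measurable_slab; have mt := measurable_shifted.
apply: le_trans (measureU2 _ _ _); [|exact: ms|exact: mt].
apply: le_measure; rewrite ?inE; first exact: measurable_simplex.
  by apply: measurableU; [exact: ms|exact: mt].
move=> t st; have [ht|th] := leP h (thead t); [right|left] => //.
move: st th; rewrite -(tcons_eta t); move: (thead t) (ttail t) => a {}t.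
rewrite /slab /mkset thead_tcons ttail_tcons.
move=> /simplex_tcons[a0 [t0 ts]] ah; rewrite a0 ah; split => //.
by split => //; lra.
Qed.

Lemma simplex_volume_gt0 n (rho : R) : 0 < rho -> (0 < simplex_volume n rho)%E.
Proof.
elim: n rho => [|n IH] rho r0; first by rewrite simplex_volume0 ?ltW.
have r20 : 0 < rho / 2 by rewrite divr_gt0.
apply: lt_le_trans (simplex_volumeS_ge n rho r20).
have -> : rho - rho / 2 = rho / 2 by lra.
apply: lt_le_trans (leeDl _ (measure_ge0 _ _)).
by rewrite mule_gt0// IH.
Qed.

End simplex.
Arguments simplex {R} n rho.

(** * Functions whose increments are squeezed by another function *)

(** The hypotheses say that [- g] is the derivative of the convex function [f],
    in a form that needs no limit. They hold for consecutive Williamson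
    transforms, where they come from the volumes of simplices. *)
Section squeezed_increments.
Context {R : realType}.
Variables (s0 : R) (f g : R -> R).
Hypothesis fge : forall z h, s0 < z -> 0 < h -> h * g (z + h) <= f z - f (z + h).
Hypothesis fle : forall z h, s0 < z -> 0 < h -> f z - f (z + h) <= h * g z.
Hypothesis g0 : forall z, s0 < z -> 0 <= g z.

Let incr z z' : s0 < z -> z < z' ->
  (z' - z) * g z' <= f z - f z' /\ f z - f z' <= (z' - z) * g z.
Proof.
move=> sz zz'; have h0 : 0 < z' - z by rewrite subr_gt0.
have zE : z + (z' - z) = z' by rewrite addrC subrK.
by have := fge sz h0; have := fle sz h0; rewrite zE.
Qed.

Lemma squeezed_nonincreasing z z' : s0 < z -> z <= z' -> g z' <= g z.
Proof.
move=> sz; rewrite le_eqVlt => /predU1P[->//|zz'].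
have [a b] := incr sz zz'; have h0 : 0 < z' - z by rewrite subr_gt0.
by rewrite -(ler_pM2l h0); exact: le_trans b.
Qed.

Lemma squeezed_continuous z : s0 < z -> {for z, continuous f}.
Proof.
move=> sz; apply/cvgrPdist_le => e e0.
(* near z the slopes of f are bounded by the value of g at z1 *)
pose z1 := (s0 + z) / 2.
have sz1 : s0 < z1 by rewrite /z1; lra.
have z1z : z1 < z by rewrite /z1; lra.
have G0 : 0 < g z1 + 1 by rewrite ltr_wpDl// g0.
near=> t.
have z1t : z1 < t by near: t; exact: lt_nbhsr.
have tze : `|z - t| <= e / (g z1 + 1).
  near: t; apply: cvgr_dist_le; [exact: cvg_id|exact: divr_gt0].
rewrite ler_pdivlMr// in tze; apply: le_trans tze.
have gz := g0 sz1.
have [tz|zt|->] := ltgtP t z; last by rewrite !subrr normr0 mul0r.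
- have [a b] := incr (lt_trans sz1 z1t) tz.
  have c := squeezed_nonincreasing sz1 (ltW z1t).
  have d := g0 sz.
  rewrite ler0_norm; last first.
    by rewrite subr_le0 -subr_ge0 (le_trans _ a)// mulr_ge0// subr_ge0 ltW.
  by rewrite gtr0_norm ?subr_gt0//; nra.
- have [a b] := incr sz zt.
  have c := squeezed_nonincreasing sz1 (ltW z1z).
  have d := g0 (lt_trans sz zt).
  rewrite ger0_norm; last first.
    by rewrite (le_trans _ a)// mulr_ge0// subr_ge0 ltW.
  by rewrite ltr0_norm ?subr_lt0//; nra.
Unshelve. all: by end_near. Qed.

(** The difference quotient of [f] lies between the values of [- g] at both
    ends. The function [k] is free on the left of [s0], where the
    generator need not be a Williamson transform. *)
Lemma squeezed_derive1 (k : R -> R) c z : s0 < z ->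
  (forall y, s0 < y -> k y = c * f y) -> {for z, continuous g} ->
  derive1 k z = - c * g z.
Proof.
move=> sz kE gz; rewrite /derive1; apply: cvg_lim => //.
apply/cvgrPdist_le => e e0.
(* the added 1 covers the case c = 0 *)
pose e' := e / (`|c| + 1).
have e'0 : 0 < e' by rewrite divr_gt0// ltr_wpDl.
have gzh : \forall h \near 0^', `|g z - g (h + z)| <= e'.
  have : (fun h => g (h + z)) @ 0 --> g z.
    rewrite -[X in _ --> g X]add0r.
    apply: (@continuous_comp _ _ _ (fun h => h + z) g); last by rewrite add0r.
    by apply: cvgD; [exact: cvg_id|exact: cvg_cst].
  by move=> /cvgr_dist_le /(_ _ e'0); exact: nbhs_dnbhs.
near=> h.
have h0 : h != 0 by near: h; exact: nbhs_dnbhs_neq.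
have shz : s0 < h + z.
  rewrite -ltrBlDr; near: h; apply: nbhs_dnbhs.
  by apply: lt_nbhsr; rewrite subr_lt0.
rewrite kE// kE//.
have gh : `|g z - g (h + z)| <= e' by near: h.
have key : `|g z + h^-1 * (f (h + z) - f z)| <= `|g z - g (h + z)|.
  have [q qE] : {q | q = h^-1 * (f (h + z) - f z)} by eexists.
  have hq : h * q = f (h + z) - f z by rewrite qE mulrA divff// mul1r.
  rewrite -qE; have [hn|hp|hz] := ltgtP h 0; last by rewrite hz eqxx in h0.
  - have hzz : h + z < z by lra.
    have [a b] := incr shz hzz.
    have zh : z - (h + z) = - h by lra.
    rewrite -hq zh in a b.
    have mono := squeezed_nonincreasing shz (ltW hzz).
    rewrite ler0_norm; last by nra.
    by rewrite ler0_norm; [nra|lra].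
  - have hzz : z < h + z by lra.
    have [a b] := incr sz hzz.
    have fq : f z - f (h + z) = - (h * q) by rewrite hq opprB.
    rewrite fq addrK in a b.
    have mono := squeezed_nonincreasing sz (ltW hzz).
    rewrite ger0_norm; last by nra.
    by rewrite ger0_norm; [nra|lra].
rewrite (_ : _ - _ = - c * (g z + h^-1 * (f (h + z) - f z))); last first.
  by rewrite /GRing.scale/=; ring.
rewrite normrM normrN.
apply: (@le_trans _ _ (`|c| * e')).
  by rewrite ler_wpM2l// (le_trans key).
rewrite /e' mulrCA ler_piMr ?(ltW e0)// ler_pdivrMr ?ltr_wpDl// mul1r.
by rewrite lerDl.
Unshelve. all: by end_near. Qed.

End squeezed_increments.

(** * The Williamson transform *)

Section williamson.
Context {R : realType}.
Notation lam := (@lebesgue_measure R).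
Notation lamt := (lebesgue_tuple R).
Variable gam : probability R R.

(** Up to the normalization by [n`!], the integral of [(r - z)_+ ^ n]: volumes
    of simplices replace the powers, since only their increments matter. *)
Definition williamson n (z : R) : \bar R :=
  (\int[gam]_r simplex_volume n (r - z))%E.

Let measurable_rays n (y : 'I_n -> R) (z : R) :
  measurable [set p : R * n.-tuple R |
    upper_box y p.2 /\ tsum p.2 <= p.1 - z].
Proof.
apply: measurableI.
  by apply: (measurable_preimageT (f := snd)) => //; exact: measurable_upper_box.
rewrite -[X in measurable X]setTI; apply: measurable_fun_le => //.
  exact: measurable_fun_tsum.
by apply: measurable_funB.
Qed.

Let measurable_simplex_sub n z :
  measurable_fun setT (fun r : R => simplex_volume n (r - z)).
Proof.
exact: (measurable_sectionl (lamt n) (@measurable_rays n (fun=> 0) z)).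
Qed.

Lemma williamson_ge0 n z : (0 <= williamson n z)%E.
Proof. by apply: integral_ge0 => r _; exact: simplex_volume_ge0. Qed.

(** Translating the corner [y] of the box to the origin shortens the simplex by
    the sum of [y]. *)
Lemma williamson_upper_box n (y : 'I_n -> R) z :
  (gam \x lamt n)%E [set p : R * n.-tuple R |
    upper_box y p.2 /\ tsum p.2 <= p.1 - z] =
  williamson n (z + \sum_i y i).
Proof.
rewrite product_sectionsl; apply: eq_integral => r _.
rewrite -(lebesgue_tuple_translate [tuple y i | i < n]); last first.
  have := measurable_xsection r (measurable_rays y z).
  by rewrite xsectionE.
congr (lebesgue_tuple R n _); apply/seteqP.
have sy : tsum [tuple y i | i < n] = \sum_i y i.
  by apply: eq_bigr => i _; rewrite tnth_mktuple.
split => t /=; rewrite /upper_box /simplex /mkset tsum_tadd sy => -[h1 h2];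
  split; try lra; move=> i; have := h1 i;
  by rewrite tnth_tadd tnth_mktuple lerDl.
Qed.

Lemma williamsonS_ge n z h : 0 < h ->
  (h%:E * williamson n (z + h) + williamson n.+1 (z + h)
    <= williamson n.+1 z)%E.
Proof.
move=> h0; rewrite /williamson -ge0_integralZl//; last by rewrite lee_fin ltW.
rewrite -ge0_integralD//; last 2 first.
- by move=> *; rewrite mule_ge0 ?simplex_volume_ge0// lee_fin (ltW h0).
- exact: measurable_funeM.
apply: ge0_le_integral => //.
- move=> *; rewrite adde_ge0 ?simplex_volume_ge0//.
  by rewrite mule_ge0 ?simplex_volume_ge0// lee_fin (ltW h0).
- by apply: emeasurable_funD => //; exact: measurable_funeM.
- move=> r _; have -> : r - (z + h) = r - z - h by lra.
  exact: simplex_volumeS_ge.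
Qed.

Lemma williamsonS_le n z h : 0 < h ->
  (williamson n.+1 z <=
    h%:E * williamson n z + williamson n.+1 (z + h))%E.
Proof.
move=> h0; rewrite /williamson -ge0_integralZl//; last by rewrite lee_fin ltW.
rewrite -ge0_integralD//; last 2 first.
- by move=> *; rewrite mule_ge0 ?simplex_volume_ge0// lee_fin (ltW h0).
- exact: measurable_funeM.
apply: ge0_le_integral => //.
- by apply: emeasurable_funD => //; exact: measurable_funeM.
- move=> r _; have -> : r - (z + h) = r - z - h by lra.
  exact: simplex_volumeS_le.
Qed.

(** Whatever the dimension, the transform is positive at [z] as soon as [gam]
    charges the half-line on the right of [z]. *)
Lemma williamson_gt0 m n z z' : z < z' -> (0 < williamson n z')%E ->
  (0 < williamson m z)%E.
Proof.
move=> zz' W0; rewrite lt0e williamson_ge0 andbT; apply: contraTneq W0 => Wz.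
rewrite -leNgt le_eqVlt; apply/orP; left; apply/eqP.
have null k y : (williamson k y = 0)%E <->
    gam [set r | simplex_volume k (r - y) != 0%E] = 0%E.
  by apply: ge0_integral_eq0P => // r; exact: simplex_volume_ge0.
have mn0 k y : measurable [set r : R | simplex_volume k (r - y) != 0%E].
  exact: measurable_neq0.
apply/null; apply: (@subset_measure0 _ _ _ gam _
  [set r | simplex_volume m (r - z) != 0%E]) => //; last exact/null.
move=> r /= rz'; rewrite gt_eqF// simplex_volume_gt0// subr_gt0.
apply: lt_le_trans zz' _; rewrite -subr_ge0 leNgt.
by apply: contra_neqN rz' => /simplex_volume_lt0.
Qed.

Section finite.
Variables (n : nat) (s0 : R).
Hypothesis fin_n : forall z, s0 < z -> (williamson n z < +oo)%E.

(** Descending induction: J_j(z) is at most [h^-1] times J_{j+1}(z - h). *)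
Lemma williamson_lty j z : (j <= n)%N -> s0 < z -> (williamson j z < +oo)%E.
Proof.
move=> jn; rewrite -(subKn jn); move: (leq_subr j n).
elim: (n - j)%N z => [|k IH] z kn sz; first by rewrite subn0; exact: fin_n.
pose h := (z - s0) / 2.
have h0 : 0 < h by rewrite divr_gt0// subr_gt0.
have := @williamsonS_ge (n - k.+1) (z - h) h h0.
rewrite subrK -subSn// subSS => /le_lt_trans/(_ (IH _ (ltnW kn) _)).
have szh : s0 < z - h by rewrite /h; lra.
move=> /(_ szh) /(le_lt_trans (leeDl _ (williamson_ge0 _ _))).
by apply: contraTT; rewrite -!leNgt !leye_eq => /eqP ->; rewrite gt0_muley.
Qed.

End finite.
End williamson.

Section real_williamson.
Context {R : realType}.
Variables (gam : probability R R) (n : nat) (s0 : R).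
Hypothesis fin_n : forall z, s0 < z -> (williamson gam n z < +oo)%E.
Hypothesis pos_n : forall z, s0 < z -> (0 < williamson gam n z)%E.

Definition williamsonr j z : R := fine (williamson gam j z).

Lemma williamsonrE j z : (j <= n)%N -> s0 < z ->
  williamson gam j z = (williamsonr j z)%:E.
Proof.
move=> jn sz; rewrite fineK// ge0_fin_numE ?williamson_ge0//.
exact: (williamson_lty fin_n).
Qed.

Lemma williamsonr_gt0 j z : (j <= n)%N -> s0 < z -> 0 < williamsonr j z.
Proof.
move=> jn sz; rewrite -lte_fin -williamsonrE//.
have z1 : z < z + 1 by rewrite ltrDl.
by apply: (@williamson_gt0 _ gam j n z _ z1); rewrite pos_n// (lt_trans sz).
Qed.

Lemma williamsonrS_ge j z h : (j < n)%N -> s0 < z -> 0 < h ->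
  h * williamsonr j (z + h) <= williamsonr j.+1 z - williamsonr j.+1 (z + h).
Proof.
move=> jn sz h0; have szh : s0 < z + h by rewrite (lt_trans sz)// ltrDl.
have := williamsonS_ge gam j z h0.
by rewrite !williamsonrE// ?(ltnW jn)// -EFinM -EFinD lee_fin lerBrDr.
Qed.

Lemma williamsonrS_le j z h : (j < n)%N -> s0 < z -> 0 < h ->
  williamsonr j.+1 z - williamsonr j.+1 (z + h) <= h * williamsonr j z.
Proof.
move=> jn sz h0; have szh : s0 < z + h by rewrite (lt_trans sz)// ltrDl.
have := williamsonS_le gam j z h0.
by rewrite !williamsonrE// ?(ltnW jn)// -EFinM -EFinD lee_fin lerBlDr.
Qed.

Let squeeze j : (j < n)%N ->
  [/\ forall z h, s0 < z -> 0 < h ->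
        h * williamsonr j (z + h) <= williamsonr j.+1 z - williamsonr j.+1 (z + h),
      forall z h, s0 < z -> 0 < h ->
        williamsonr j.+1 z - williamsonr j.+1 (z + h) <= h * williamsonr j z
    & forall z, s0 < z -> 0 <= williamsonr j z].
Proof.
move=> jn; split=> [z h|z h|z sz].
- exact: williamsonrS_ge.
- exact: williamsonrS_le.
by apply/ltW/williamsonr_gt0 => //; exact: ltnW.
Qed.

Lemma williamsonr_continuous j z : (0 < j <= n)%N -> s0 < z ->
  {for z, continuous (williamsonr j)}.
Proof.
case: j => // j /= jn sz; have [h1 h2 h3] := squeeze jn.
exact: (squeezed_continuous h1 h2 h3).
Qed.

Lemma williamsonr_nonincreasing j z z' : (j < n)%N -> s0 < z -> z <= z' ->
  williamsonr j z' <= williamsonr j z.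
Proof.
move=> jn; have [h1 h2 h3] := squeeze jn.
exact: (squeezed_nonincreasing h1 h2).
Qed.

Lemma williamsonr_decreasing j z z' : (0 < j <= n)%N -> s0 < z -> z < z' ->
  williamsonr j z' < williamsonr j z.
Proof.
case: j => // j /= jn sz zz'; have h0 : 0 < z' - z by rewrite subr_gt0.
have zE : z + (z' - z) = z' by rewrite addrC subrK.
have := williamsonrS_ge jn sz h0; rewrite zE -subr_gt0; apply: lt_le_trans.
by rewrite mulr_gt0// williamsonr_gt0// ?(ltnW jn)// (lt_trans sz).
Qed.

Lemma williamsonr_lipschitz j s a b : (j < n)%N -> s0 < s -> s <= a -> s <= b ->
  `|williamsonr j.+1 a - williamsonr j.+1 b| <= williamsonr j s * `|a - b|.
Proof.
move=> jn ss; wlog : a b / a <= b => [H sa sb|ab sa sb].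
  have [ab|/ltW ba] := leP a b; first exact: H.
  by rewrite distrC (distrC a) H.
move: ab; rewrite le_eqVlt => /predU1P[->|ab].
  by rewrite !subrr normr0 mulr0.
have sa' := lt_le_trans ss sa; have h0 : 0 < b - a by rewrite subr_gt0.
have b' : a + (b - a) = b by rewrite addrC subrK.
have := williamsonrS_le jn sa' h0; rewrite b' => le.
rewrite gtr0_norm; last first.
  by rewrite subr_gt0 williamsonr_decreasing.
rewrite ltr0_norm ?subr_lt0// opprB (le_trans le)// mulrC.
by rewrite ler_wpM2r ?(ltW h0)// williamsonr_nonincreasing.
Qed.

Lemma williamsonr_cvg0 j : (j <= n)%N ->
  williamsonr n z @[z --> +oo] --> 0 -> williamsonr j z @[z --> +oo] --> 0.
Proof.
move=> jn wn; rewrite -(subKn jn); move: (leq_subr j n).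
elim: (n - j)%N => [|k IH] kn; first by rewrite subn0.
apply/cvgrPdist_le => e e0.
have /cvgrPdist_le/(_ _ e0)[M [_ MP]] := IH (ltnW kn).
exists (Num.max M (s0 + 1) + 1); split; first exact: num_real.
move=> z zM; have sz : s0 < z - 1.
  by rewrite ltrBrDr (le_lt_trans _ zM)// lerD2r le_max lerDl ler01 orbT.
have Mz : M < z - 1.
  by rewrite ltrBrDr (le_lt_trans _ zM)// lerD2r le_max lexx.
have := MP _ Mz; rewrite !sub0r !normrN.
have kn1 : (n - k.+1 < n)%N by lia.
have := williamsonrS_ge kn1 sz ltr01; rewrite subrK mul1r -subSn// subSS => le.
have k1 : s0 < z by rewrite (lt_trans sz)// ltrBlDr ltrDl.
rewrite !gtr0_norm ?williamsonr_gt0 ?leq_subr//.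
apply: le_trans; apply: (le_trans le); rewrite gerBl ltW// williamsonr_gt0//.
exact: leq_subr.
Qed.

(** Each differentiation lowers the dimension of the simplices by one. The
    bound [l < n] leaves a transform of dimension at least one, which is
    continuous. *)
Lemma derive1n_williamsonr (psi : R -> R) c l z : (l < n)%N ->
  (forall y, s0 < y -> psi y = c * williamsonr n y) -> s0 < z ->
  derive1n l psi z = (- 1) ^+ l * c * williamsonr (n - l) z.
Proof.
move=> ln psiE; elim: l ln z => [|l IH] ln z sz.
  by rewrite derive1n0 expr0 mul1r subn0 psiE.
have nl : (n - l.+1 < n)%N by lia.
have [h1 h2 h3] := squeeze nl.
rewrite derive1nS (squeezed_derive1 h1 h2 (c := (-1) ^+ l * c))//.
- by rewrite exprS mulN1r !mulNr.
- have nlE : (n - l = (n - l.+1).+1)%N by lia.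
  by move=> y sy; rewrite IH ?(ltnW ln)// nlE.
- by apply: williamsonr_continuous => //; rewrite subn_gt0 ln leq_subr.
Qed.

End real_williamson.

(** * Strict generators and their inverses *)

(** The common features of [psi] and of the survival function of a conditional
    margin, which are both inverted below. *)
Definition survival_fun (R : realType) (F : R -> R) : Prop :=
  [/\ {within `[0, +oo[, continuous F}, F 0 = 1,
      forall a b, 0 <= a -> a < b -> F b < F a,
      forall a, 0 <= a -> 0 < F a
    & F z @[z --> +oo] --> 0].

(** The value [-1] outside of (0, 1] keeps the exceptional points out of the
    orthant. *)
Definition survival_inverse (R : realType) (F G : R -> R) : Prop :=
  [/\ measurable_fun setT G,
      forall x, 0 < x <= 1 -> 0 <= G x /\ F (G x) = x
    & forall x, ~~ (0 < x <= 1) -> G x = -1].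

Section survival.
Context {R : realType} (F : R -> R).
Hypothesis sF : survival_fun F.

Lemma survival_le a b : 0 <= a -> 0 <= b -> (F b <= F a) = (a <= b).
Proof.
have [_ _ dF _ _] := sF; move=> a0 b0.
have [ab|ba|->] := ltgtP a b; last by rewrite lexx.
- by rewrite ltW// dF.
- by apply/negbTE; rewrite -ltNge dF.
Qed.

Lemma survival_inj a b : 0 <= a -> 0 <= b -> F a = F b -> a = b.
Proof.
move=> a0 b0 ab; apply/eqP; rewrite eq_le -(survival_le a0 b0).
by rewrite -(survival_le b0 a0) ab lexx.
Qed.

Lemma survival_itv a : 0 <= a -> 0 < F a <= 1.
Proof.
by have [_ F0 _ pF _] := sF => a0; rewrite pF//= -F0 survival_le.
Qed.

Lemma measurable_survival : measurable_fun setT (fun x : R => F (Num.max x 0)).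
Proof.
apply: nonincreasing_measurable => // x y xy.
rewrite survival_le; [|by rewrite le_max lexx orbT..].
by rewrite ge_max !le_max xy lexx orbT.
Qed.

Lemma survival_surj x : 0 < x <= 1 -> exists2 a, 0 <= a & F a = x.
Proof.
have [cF F0 dF pF F_0] := sF; move=> /andP[x0 x1].
have /cvgrPdist_lt/(_ _ x0)[M [_ MP]] := F_0.
pose b := Num.max M 0 + 1.
have b0 : 0 < b by rewrite ltr_wpDl// le_max lexx orbT.
have Fbx : F b < x.
  have := MP b; rewrite sub0r normrN gtr0_norm ?pF ?(ltW b0)//; apply.
  by rewrite /b ltr_pwDr// le_max lexx.
have Fb1 : F b <= 1 by rewrite -F0 survival_le// ltW.
have [||c cb Fc] := IVT (ltW b0) (f := F) (v := x).
- apply: continuous_subspaceW cF => y /=; rewrite !in_itv/= => /andP[-> _].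
  by [].
- by rewrite F0 ge_min le_max (ltW Fbx) x1 orbT.
- by exists c => //; move: cb; rewrite in_itv/= => /andP[].
Qed.

Section inverse.
Variable G : R -> R.
Hypothesis GE : forall x, 0 < x <= 1 -> 0 <= G x /\ F (G x) = x.
Hypothesis GN : forall x, ~~ (0 < x <= 1) -> G x = -1.

Lemma survival_inverse_ge a x : 0 <= a -> (a <= G x) = (0 < x <= F a).
Proof.
move=> a0; have /andP[_ Fa1] := survival_itv a0.
have [x01|xn] := boolP (0 < x <= 1).
  have [Gx0 FGx] := GE x01; have /andP[x0 _] := x01.
  by rewrite x0 -(survival_le a0 Gx0) FGx.
rewrite (GN xn) leNgt (lt_le_trans _ a0) ?ltrN10//=.
by apply/esym/negbTE; apply: contra xn => /andP[-> /le_trans->].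
Qed.

Lemma measurable_survival_inverse : measurable_fun setT G.
Proof.
apply: (@measurability _ _ _ _ _ _ (@RGenCInfty.G R)).
  exact: RGenCInfty.measurableE.
move=> _ [_ [a ->] <-]; rewrite setTI.
have [a0|a0] := leP 0 a.
  rewrite (_ : _ @^-1` _ = `]0, F a]%classic); first exact: measurable_itv.
  by apply/seteqP; split => x; rewrite /preimage/= !in_itv/= andbT
    survival_inverse_ge.
have [a1|a1] := leP a (-1).
  rewrite (_ : _ @^-1` _ = setT)//; apply/seteqP; split => // x _.
  rewrite /preimage/= in_itv/= andbT.
  have [/GE[Gx _]|/GN ->//] := boolP (0 < x <= 1).
  exact: le_trans (ltW a0) Gx.
rewrite (_ : _ @^-1` _ = `]0, 1]%classic); first exact: measurable_itv.
apply/seteqP; split => x; rewrite /preimage/= !in_itv/= andbT.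
  by have [//|/GN ->] := boolP (0 < x <= 1); rewrite leNgt a1.
by move=> /GE[Gx _]; exact: le_trans (ltW a0) Gx.
Qed.

End inverse.

Lemma survival_inverse_exists : exists G, survival_inverse F G.
Proof.
have /choice[G GP] x : exists a, (0 < x <= 1 -> 0 <= a /\ F a = x) /\
    (~~ (0 < x <= 1) -> a = -1).
  case: (boolP (0 < x <= 1)) => [/survival_surj[a a0 Fa]|xn].
    by exists a; split.
  by exists (-1).
have GE x := (GP x).1; have GN x := (GP x).2.
by exists G; split => //; exact: measurable_survival_inverse.
Qed.

Lemma survival_inverseK G a : survival_inverse F G -> 0 <= a -> G (F a) = a.
Proof.
move=> [_ GE _] a0; have [GF0 FGF] := GE _ (survival_itv a0).
exact: survival_inj.
Qed.

End survival.

Section generator_facts.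
Context {R : realType} (psi : R -> R).
Hypotheses (gpsi : generator psi) (spsi : strict psi).

Lemma generator_survival : survival_fun psi.
Proof.
have [cpsi [psi01 psi_le] [psi0 psi_cvg] psi_lt _] := gpsi.
split => //.
- by move=> a b a0 ab; apply: (psi_lt a%:E b%:E);
    rewrite ?lee_fin ?lte_fin// spsi leey.
- by move=> a a0; apply: (psi_lt a%:E +oo%E);
    rewrite ?lee_fin ?ltry// spsi leey.
Qed.

Lemma pseudoinverse_gen a : 0 <= a -> pseudoinverse psi (psi a) = a%:E.
Proof.
move=> a0; rewrite /pseudoinverse (_ : [set z | _] = [set a%:E]) ?ereal_inf1//.
have sF := generator_survival; have [_ _ _ pF _] := sF.
apply/seteqP; split => [[z| |] /= []|_ ->] //=.
- by rewrite lee_fin => z0 /(survival_inj sF z0 a0) ->.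
- by move=> _ /eqP; rewrite lt_eqF// pF.
Qed.

Lemma pseudoinverseE G x : survival_inverse psi G -> 0 < x <= 1 ->
  pseudoinverse psi x = (G x)%:E.
Proof.
by move=> [_ GE _] /GE[Gx0 {1}<-]; rewrite pseudoinverse_gen.
Qed.

End generator_facts.

(** * Measures invariant along the level sets of the sum *)

Section law.
Context d d' (T : measurableType d) (T' : measurableType d') {R : realType}.
Variables (P : probability T R) (f : T -> T').
Hypothesis mf : measurable_fun setT f.

Let f_mixin := isMeasurableFun.Build _ _ _ _ _ mf.
Let f_pack : {mfun T >-> T'} := HB.pack f f_mixin.

(** [distribution] asks for a bundled measurable function. *)
Definition law : probability T' R := distribution P f_pack.

Lemma lawE A : law A = P [set x | A (f x)].
Proof. by []. Qed.

Lemma ge0_integral_law (g : T' -> \bar R) : measurable_fun setT g ->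
  (forall y, 0 <= g y)%E -> (\int[law]_y g y = \int[P]_x g (f x))%E.
Proof. by move=> mg g0; exact: (ge0_integral_distribution f_pack mg g0). Qed.

End law.

Section shift_invariance.
Context {R : realType} (n : nat).
Notation lamt := (lebesgue_tuple R).
Variables (mu : probability (n.+1.-tuple R) R) (F : R -> R).
Hypothesis mu_upper_box : forall a : 'I_n.+1 -> R, (forall i, 0 <= a i) ->
  mu (upper_box a) = (F (\sum_i a i))%:E.

Lemma measurable_fun_ttail d (T : measurableType d) (g : T -> n.+1.-tuple R) :
  measurable_fun setT g -> measurable_fun setT (fun x => ttail (g x)).
Proof.
move=> mg.
by apply: (@measurableT_comp _ _ _ _ _ _ (@ttail R n)) => //; exact: measurable_behead.
Qed.

(** Both sides, as measures of [A], agree on upper boxes: a translation by [w]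
    does not change the sum of the corner. Boxes with corners in the orthant
    suffice, because [A] and its translate lie there. *)
Lemma orthant_shift_invariant (w : n.+1.-tuple R) (A : set (n.+1.-tuple R)) :
  tsum w = 0 -> measurable A ->
  A `<=` upper_box (fun=> 0) ->
  [set x | A (tadd w x)] `<=` upper_box (fun=> 0) ->
  mu [set x | A (tadd w x)] = mu A.
Proof.
move=> w0 mA A0 Aw0.
(* A lies in the box with corner c, whose translate by - w is in the orthant *)
pose c i := Num.max 0 (tnth w i).
have mc := @measurable_upper_box R _ c.
have mw : measurable_fun setT (fun x : n.+1.-tuple R => tadd w x).
  exact: (measurable_fun_tadd (f := fun=> w) (g := id)).
have UI a b : @upper_box R n.+1 a `&` upper_box b =
    upper_box (fun i => Num.max (a i) (b i)).
  apply/seteqP; split => t /=.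
    by move=> [h1 h2] i; rewrite ge_max h1 h2.
  by move=> h; split => i; have := h i; rewrite ge_max => /andP[].
have Ac : A `&` upper_box c = A.
  apply/setIidPl => x Ax i; rewrite /c ge_max (A0 x Ax i)/=.
  pose y : n.+1.-tuple R := [tuple tnth x i - tnth w i | i < n.+1].
  have xE : x = tadd w y.
    by apply: eq_from_tnth => j; rewrite tnth_tadd tnth_mktuple addrC subrK.
  have := Aw0 y; rewrite /= -xE => /(_ Ax i).
  by rewrite tnth_mktuple subr_ge0.
suff : mrestr mu mc A = mrestr (law mu mw) mc A.
  by rewrite /mrestr Ac.
apply: (upper_box_measure_unique (m1 := mrestr mu mc)
  (m2 := mrestr (law mu mw) mc)) => //.
  by rewrite /= /mrestr (le_lt_trans (probability_le1 _ _))// ?ltry//;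
    exact: measurableI.
move=> a; rewrite /= /mrestr UI.
rewrite mu_upper_box; last by move=> i; rewrite /c !le_max lexx orbT.
rewrite -[RHS]/(mu [set x | upper_box _ (tadd w x)]).
pose b i := Num.max (a i) (c i) - tnth w i.
rewrite (_ : [set x | _] = upper_box b); last first.
  by apply/seteqP; split => x h i; have := h i;
    rewrite /b tnth_tadd lerBlDl.
rewrite mu_upper_box; last first.
  by move=> i; rewrite /b /c subr_ge0 !le_max lexx !orbT.
congr (F _)%:E; rewrite /b big_split/= -[LHS]addr0; congr (_ + _).
by rewrite sumrN -/(tsum w) w0 oppr0.
Qed.

Section cube.
Variable e : R.
Hypothesis e0 : 0 < e.

Let s0 := n%:R * e.

Definition cube_slice : set (n.+1.-tuple R) :=
  [set x | s0 < tsum x /\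
    forall i, `[0, e[%classic (tnth (ttail x) i)].

(** The sum is replaced by 0 off the slice so that the law of this function is
    a probability measure; on the right of [s0] it is the law of the sum
    restricted to the slice. *)
Definition cube_sum (x : n.+1.-tuple R) : R :=
  if x \in cube_slice then tsum x else 0.

Let measurable_cube_slice : measurable cube_slice.
Proof.
rewrite (_ : cube_slice = [set x | `]s0, +oo[%classic (tsum x)] `&`
    [set x | forall i, `[0, e[%classic (tnth (ttail x) i)]); last first.
  by apply/seteqP; split => x; rewrite /setI/= in_itv/= andbT.
apply: measurableI.
  apply: (measurable_preimageT (f := @tsum R n.+1)) => //.
  exact: (measurable_fun_tsum (g := id)).
apply: (measurable_preimageT
  (A := [set t : n.-tuple R | forall i, `[0, e[%classic (tnth t i)])).
  exact: (measurable_fun_ttail (g := id)).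
by apply: (measurable_forall_tnth (A := fun=> `[0, e[%classic)).
Qed.

Lemma measurable_cube_sum : measurable_fun setT cube_sum.
Proof.
apply: measurable_fun_ifT.
- apply: (measurable_fun_bool true); rewrite setTI.
  rewrite (_ : _ @^-1` _ = cube_slice)//.
  by apply/seteqP; split => x; [exact: set_mem|exact: mem_set].
- exact: (measurable_fun_tsum (g := id)).
- exact: measurable_cst.
Qed.

Definition radial := law mu measurable_cube_sum.

(* the direction of zero sum along which the tail moves by v *)
Let level_shift (v : n.-tuple R) : n.+1.-tuple R := tcons (- tsum v) v.

Let tsum_level_shift v : tsum (level_shift v) = 0.
Proof. by rewrite tsum_cons addNr. Qed.

Let measurable_level_shift d (T : measurableType d) (g : T -> n.-tuple R)
    (f : T -> n.+1.-tuple R) : measurable_fun setT g -> measurable_fun setT f ->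
  measurable_fun setT (fun p => tadd (level_shift (g p)) (f p)).
Proof.
move=> mg mf; apply: measurable_fun_tadd => //; apply: measurable_fun_tcons => //.
by apply: measurable_funN; exact: measurable_fun_tsum.
Qed.

(** Integrate over [v] the measure of the [x] in the slice whose shift by [v]
    lies in [E]. For fixed [x] this is the Lebesgue measure of the part of [E]
    on the level of [x], so that the integral is the right-hand side. For fixed
    [v], invariance replaces [x] by its shift [y], and the [v] that come from a
    given [y] in [E] fill a cube of volume [e ^+ n]: this is the left-hand
    side. *)
Lemma radial_decomposition (E : set (n.+1.-tuple R)) : measurable E ->
  E `<=` upper_box (fun=> 0) -> (forall x, E x -> s0 < tsum x) ->
  ((e ^+ n)%:E * mu E = (radial \x lamt n)
    [set p : R * n.-tuple R | E (tcons (p.1 - tsum p.2) p.2)])%E.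
Proof.
move=> mE E0 Es.
(* S1 pairs x with its shift, S2 is the same set seen from y *)
pose S1 : set (n.+1.-tuple R * n.-tuple R) :=
  [set p | cube_slice p.1 /\ E (tadd (level_shift p.2) p.1)].
pose Q (y : n.+1.-tuple R) (v : n.-tuple R) :=
  forall i, `[0, e[%classic (tnth (ttail y) i - tnth v i).
pose S2 : set (n.+1.-tuple R * n.-tuple R) := [set p | E p.1 /\ Q p.1 p.2].
have mS1 : measurable S1.
  apply: measurableI.
    exact: (measurable_preimageT (f := fst)).
  apply: (measurable_preimageT (f := fun p : n.+1.-tuple R * n.-tuple R =>
    tadd (level_shift p.2) p.1)) => //.
  exact: measurable_level_shift.
have mQ : measurable [set p | Q p.1 p.2].
  pose g (p : n.+1.-tuple R * n.-tuple R) :=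
    [tuple tnth (ttail p.1) i - tnth p.2 i | i < n].
  rewrite (_ : mkset _ =
      [set p | forall i, `[0, e[%classic (tnth (g p) i)]); last first.
    by apply/seteqP; split => p h i; have := h i; rewrite /g tnth_mktuple.
  apply: (measurable_preimageT (f := g)
    (A := [set t : n.-tuple R | forall i, `[0, e[%classic (tnth t i)])).
    apply/measurable_fun_tnthP => i.
    rewrite (_ : _ \o _ = fun p => tnth (ttail p.1) i - tnth p.2 i); last first.
      by apply/funext => p; rewrite /g /= tnth_mktuple.
    apply: measurable_funB; apply: measurable_fun_tnth => //.
    exact: measurable_fun_ttail.
  by apply: (measurable_forall_tnth (A := fun=> `[0, e[%classic)).
have mS2 : measurable S2.
  apply: measurableI => //.
  exact: (measurable_preimageT (f := fst)).
have mE' : measurable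
    [set p : R * n.-tuple R | E (tcons (p.1 - tsum p.2) p.2)].
  apply: (measurable_preimageT (f := fun p : R * n.-tuple R =>
    tcons (p.1 - tsum p.2) p.2)) => //.
  apply: measurable_fun_tcons => //; apply: measurable_funB => //.
  exact: measurable_fun_tsum.
transitivity ((mu \x lamt n)%E S2); last transitivity ((mu \x lamt n)%E S1).
- rewrite product_sectionsl.
  rewrite -[in LHS](setIT E) -(integral_indic mu measurableT mE).
  rewrite -ge0_integralZl//; last 2 first.
  + by apply/measurable_EFinP; exact: measurable_indic.
  + by rewrite lee_fin exprn_ge0// ltW.
  apply: eq_integral => y _; rewrite indicE.
  have [/set_mem Ey|yE] := boolP (y \in E); last first.
    rewrite mule0 (_ : [set _ | _] = set0) ?measure0//.
    by apply/seteqP; split => // v [Ey _]; rewrite mem_set in yE.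
  rewrite mule1.
  rewrite (_ : [set _ | _] = [set v : n.-tuple R | forall i,
      `](tnth (ttail y) i - e), (tnth (ttail y) i)]%classic (tnth v i)]).
    rewrite (lebesgue_tuple_box (A := fun i =>
      `](tnth (ttail y) i - e), (tnth (ttail y) i)]%classic)); last first.
      by move=> i; exact: measurable_itv.
    rewrite (eq_bigr (fun=> e%:E)) => [|i _].
      by rewrite prodEFin prodr_const card_ord.
    rewrite lebesgue_measure_itv/= lte_fin ltrBlDr ltrDl e0.
    by rewrite -EFinD; congr (_%:E); ring.
  apply/seteqP; split => v.
    move=> [_ h] i; have := h i; rewrite /= !in_itv/= => /andP[? ?].
    by apply/andP; split; lra.
  move=> h; split => // i; have := h i; rewrite /= !in_itv/= => /andP[? ?].
  by apply/andP; split; lra.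
- rewrite (product_sectionsr mu (lamt n) mS2) (product_sectionsr mu (lamt n) mS1).
  apply: eq_integral => v _.
  pose A := [set y | E y /\ Q y v].
  have mA : measurable A.
    by have := measurable_ysection v mS2; rewrite ysectionE.
  have sE x : tsum (tadd (level_shift v) x) = tsum x.
    by rewrite tsum_tadd tsum_level_shift add0r.
  have tE x i : tnth (ttail (tadd (level_shift v) x)) i - tnth v i =
      tnth (ttail x) i.
    by rewrite -{1}(tcons_eta x) tadd_cons ttail_tcons tnth_tadd addrC addKr.
  have inv : mu [set x | A (tadd (level_shift v) x)] = mu A.
    apply: orthant_shift_invariant => //; first by move=> y [Ey _]; exact: E0.
    move=> x [Ex Qx] i; case: (unliftP ord0 i) => [j ->|->].
      by have := Qx j; rewrite tE /= in_itv/= => /andP[]; rewrite tnth_ttail.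
    have := Es _ Ex; rewrite sE -(tcons_eta x) tsum_cons tnth0 => sx.
    suff : tsum (ttail x) <= s0 by lra.
    have -> : s0 = \sum_(j < n) e by rewrite /s0 sumr_const card_ord mulr_natl.
    apply: ler_sum => j _; have := Qx j.
    by rewrite tE /= in_itv/= => /andP[_ /ltW].
  rewrite -[LHS]/(mu A) -inv; congr (mu _); apply/seteqP; split => x.
    move=> [Ex xQ]; split => //; split; first by rewrite -sE; exact: Es.
    by move=> i; rewrite -tE.
  by move=> [[_ xQ] Ex]; split => // i; rewrite tE.
- have mV := measurable_sectionl (lamt n) mE'.
  rewrite product_sectionsl product_sectionsl.
  rewrite (ge0_integral_law mu measurable_cube_sum mV); last first.
    by move=> y; exact: measure_ge0.
  apply: eq_integral => x _ /=; rewrite /cube_sum.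
  have [/set_mem Qx|Qx] := boolP (x \in cube_slice); last first.
    rewrite (_ : [set _ | _] = set0) ?measure0; last first.
      by apply/seteqP; split => // v [Qx' _]; rewrite mem_set in Qx.
    rewrite (_ : [set _ | _] = set0) ?measure0//.
    apply/seteqP; split => // t /= /Es; rewrite tsum_cons sub0r addNr ltNge.
    by rewrite mulr_ge0// ltW.
  rewrite -[RHS](lebesgue_tuple_translate (ttail x)); last first.
    by have := measurable_xsection (tsum x) mE'; rewrite xsectionE.
  congr (lebesgue_tuple R n _).
  have vE v : tcons (tsum x - tsum (tadd (ttail x) v)) (tadd (ttail x) v) =
      tadd (level_shift v) x.
    rewrite -{4}(tcons_eta x) tadd_cons tsum_tadd -{1}(tcons_eta x) tsum_cons.
    congr tcons; first by ring.
    by apply: eq_from_tnth => i; rewrite !tnth_tadd addrC.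
  by apply/seteqP; split => v /=; rewrite vE => // -[].
Qed.

End cube.
End shift_invariance.

(** * The radial law of an Archimedean copula *)

Section archimedean_radial.
Context {R : realType} (n : nat).
Notation lam := (@lebesgue_measure R).
Notation lamt := (lebesgue_tuple R).
Variables (C : n.+1.-tuple R -> R) (psi G : R -> R).
Variable P : probability (n.+1.-tuple R) R.
Hypotheses (hP : copula_measure C P) (gpsi : generator psi) (spsi : strict psi).
Hypothesis CE : forall x, unit_cube x ->
  C x = ext0 psi (\sum_(i < n.+1) pseudoinverse psi (tnth x i))%E.
Hypothesis GP : survival_inverse psi G.

Let sF := generator_survival gpsi spsi.

Let measurable_G : measurable_fun setT G.
Proof. by case: GP. Qed.

Definition coordinates_law : probability (n.+1.-tuple R) R :=
  law P (measurable_fun_map_tuple (n := n.+1) measurable_G).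

Let mu := coordinates_law.

Let inverse_ge a x : 0 <= a -> (a <= G x) = (0 < x <= psi a).
Proof. by have [_ GE GN] := GP; exact: (survival_inverse_ge sF GE GN). Qed.

Let measurable_lower_box (b : n.+1.-tuple R) : measurable (lower_box b).
Proof.
rewrite (_ : lower_box b =
    [set t | forall i, `[0, tnth b i]%classic (tnth t i)]); last first.
  by apply/seteqP; split => t h i; have := h i; rewrite /= in_itv.
by apply: (measurable_forall_tnth (A := fun i => `[0, tnth b i]%classic)).
Qed.

(** The inverse of the generator turns the box with corner [a] into the box
    (0, psi(a_1)] x ... x (0, psi(a_d)], which differs from the closed one by a
    null set since the margins do not charge 0. *)
Lemma coordinates_law_upper_box (a : 'I_n.+1 -> R) : (forall i, 0 <= a i) ->
  mu (upper_box a) = (psi (\sum_i a i))%:E.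
Proof.
move=> a0; have [_ Pu Pc] := hP.
pose b : n.+1.-tuple R := [tuple psi (a i) | i < n.+1].
have bE i : tnth b i = psi (a i) by rewrite tnth_mktuple.
have b01 : unit_cube b.
  by move=> i; rewrite bE; have /andP[/ltW -> ->] := survival_itv sF (a0 i).
have <- : C b = psi (\sum_i a i).
  rewrite CE// (eq_bigr (fun i => (a i)%:E)) ?sumEFin// => i _.
  by rewrite bE pseudoinverse_gen.
rewrite -(Pc _ b01) /mu /coordinates_law lawE.
pose S := [set x : n.+1.-tuple R | forall i, `]0, tnth b i]%classic (tnth x i)].
pose N := \big[setU/set0]_(i < n.+1) [set x : n.+1.-tuple R | tnth x i <= 0].
have mN0 i : measurable [set x : n.+1.-tuple R | tnth x i <= 0].
  rewrite -[X in measurable X]setTI; apply: measurable_fun_le => //.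
  exact: measurable_tnth.
have mN : measurable N by apply: bigsetU_measurable.
have mS : measurable S.
  by apply: (measurable_forall_tnth (A := fun i => `]0, tnth b i]%classic)).
have PN : P N = 0%E.
  apply/negligibleP => //; apply: (big_ind (fun A => P.-negligible A)).
  - exact: negligible_set0.
  - by move=> A B; exact: negligibleU.
  - by move=> i _; apply/negligibleP => //; apply: (Pu i 0); rewrite lexx ler01.
rewrite (_ : [set x | _] = S); last first.
  apply/seteqP; split => x h i; have := h i;
    by rewrite bE tnth_map inverse_ge//= in_itv.
apply/eqP; rewrite eq_le; apply/andP; split.
  apply: le_measure; rewrite ?inE// => x h i; have := h i.
  by rewrite /= in_itv/= => /andP[/ltW -> ->].
rewrite -[leRHS]adde0 -PN; apply: le_trans (measureU2 P mS mN).
apply: le_measure; rewrite ?inE//; first exact: measurableU.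
move=> x h; have [[i xi]|nx] := pselect (exists i, tnth x i <= 0).
  by right; rewrite /N -bigcup_seq; exists i => //=; rewrite mem_index_enum.
left => i; rewrite /= in_itv/=; have /andP[_ ->] := h i.
by rewrite andbT ltNge; apply/negP => xi; apply: nx; exists i.
Qed.

Section level.
Variable e : R.
Hypothesis e0 : 0 < e.

Let s0 := n%:R * e.

Definition radial_law : probability R R := radial mu e.

Let gam := radial_law.

(** The radial decomposition of the box where the first coordinate is at least
    [z]. *)
Lemma radial_law_williamson z : s0 < z ->
  williamson gam n z = (e ^+ n * psi z)%:E.
Proof.
move=> sz; pose a (i : 'I_n.+1) : R := if i == ord0 then z else 0.
have z0 : 0 <= z by rewrite (le_trans _ (ltW sz))// mulr_ge0// ltW.
have a0 i : 0 <= a i by rewrite /a; case: ifP.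
have sa : \sum_i a i = z.
  by rewrite big_ord_recl /a eqxx big1 ?addr0.
rewrite EFinM.
have <- : mu (upper_box a) = (psi z)%:E.
  by rewrite coordinates_law_upper_box// sa.
rewrite (radial_decomposition coordinates_law_upper_box e0)//.
- transitivity (williamson gam n (z + \sum_(i < n) 0)).
    by rewrite big1// addr0.
  rewrite -williamson_upper_box; congr (product_measure1 _ _ _).
  apply/seteqP; split => -[r t] /=.
    move=> [t0 rt]; apply/(forall_tcons _ _ (fun i x => a i <= x)).
    by split => //; rewrite /a eqxx; lra.
  move=> /(forall_tcons _ _ (fun i x => a i <= x))[].
  by rewrite {1}/a eqxx => rz t0; split => //; lra.
- exact: measurable_upper_box.
- by move=> x xa i; apply: le_trans (xa i).
- move=> x xa; rewrite (lt_le_trans sz)// -sa.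
  by apply: ler_sum => i _; exact: xa.
Qed.

Lemma radial_law_fin z : s0 < z -> (williamson gam n z < +oo)%E.
Proof. by move=> sz; rewrite radial_law_williamson// ltry. Qed.

Lemma radial_law_pos z : s0 < z -> (0 < williamson gam n z)%E.
Proof.
have [_ _ _ pF _] := sF; move=> sz.
rewrite radial_law_williamson// lte_fin mulr_gt0 ?exprn_gt0//.
by apply: pF; rewrite (le_trans _ (ltW sz))// mulr_ge0// ltW.
Qed.

Lemma generator_williamsonr z : s0 < z -> psi z = e ^- n * williamsonr gam n z.
Proof.
move=> sz; rewrite /williamsonr radial_law_williamson//= mulrA mulVf ?mul1r//.
by rewrite expf_neq0// gt_eqF.
Qed.

End level.

Hypothesis n0 : (0 < n)%N.

(** The slope of [psi] on [[a, b]] is at least its value at [b] in absolute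
    value, because [psi] is convex where it is a Williamson transform. *)
Lemma generator_expanding (a b : R) : 0 < a -> a <= b ->
  exists2 c, 0 < c & forall x y, a <= x <= b -> a <= y <= b ->
    c * `|x - y| <= `|psi x - psi y|.
Proof.
move=> a0 ab; pose e := a / (n%:R * 2).
have nR : 0 < n%:R :> R by rewrite ltr0n.
have e0 : 0 < e by rewrite divr_gt0// mulr_gt0.
have sa : n%:R * e < a.
  have -> : n%:R * e = a / 2 by rewrite /e; field; rewrite gt_eqF.
  by lra.
have nE : n.-1.+1 = n := prednK n0.
have n1 : (n.-1 < n)%N by rewrite nE.
pose w := williamsonr (radial_law e); have fin := radial_law_fin e0.
have pos := radial_law_pos e0.
have sb : n%:R * e < b := lt_le_trans sa ab.
exists (e ^- n * w n.-1 b).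
  rewrite mulr_gt0 ?invr_gt0 ?exprn_gt0//.
  by apply: (williamsonr_gt0 fin pos) => //; exact: ltnW.
move=> x y; wlog xy : x y / x <= y => [H xab yab|].
  have [xy|/ltW yx] := leP x y; first exact: H.
  by rewrite distrC (distrC (psi x)); exact: H.
move=> /andP[ax xb] /andP[ay yb].
move: xy; rewrite le_eqVlt => /predU1P[->|xy].
  by rewrite !subrr !normr0 mulr0.
have sx := lt_le_trans sa ax; have sy := lt_le_trans sa ay.
rewrite !(generator_williamsonr e0)//.
have h0 : 0 < y - x by rewrite subr_gt0.
have := williamsonrS_ge fin n1 sx h0; rewrite addrCA subrr addr0 nE => le.
have mono : w n.-1 b <= w n.-1 y := williamsonr_nonincreasing fin pos n1 sy yb.
have en : 0 < e ^- n by rewrite invr_gt0 exprn_gt0.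
rewrite -mulrBr normrM (gtr0_norm en) -mulrA ler_pM2l//.
apply: le_trans (ler_norm _); apply: le_trans le.
rewrite ltr0_norm ?subr_lt0// opprB mulrC.
by apply: ler_wpM2l => //; exact: ltW.
Qed.

Let hpsi x := psi (Num.max x 0).

Lemma lebesgue_measure0_generator (A : set R) : measurable A -> lam A = 0%E ->
  lam (`[0, +oo[ `&` hpsi @^-1` A) = 0%E.
Proof.
move=> mA A0.
have mh : measurable_fun setT hpsi := measurable_survival sF.
(* psi expands on each of these intervals, which exhaust (0, oo) *)
pose I k := `[k.+1%:R^-1, k.+1%:R]%classic : set R.
have mI k : measurable (I k `&` hpsi @^-1` A).
  by apply: measurableI; [exact: measurable_itv|exact: measurable_preimageT].
have I0 k : lam (I k `&` hpsi @^-1` A) = 0%E.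
  have k0 : 0 < k.+1%:R^-1 :> R by rewrite invr_gt0.
  have kk : k.+1%:R^-1 <= k.+1%:R :> R.
    by rewrite (@le_trans _ _ 1)// ?invf_le1 ?ler1n.
  have [c c0 hc] := generator_expanding k0 kk.
  apply: (lebesgue_measure0_expanding c0 mh (measurable_itv _) mA _ A0) => x y.
  rewrite /I /= !in_itv/= => xk yk; rewrite /hpsi.
  have x0 : 0 <= x by case/andP: xk => /(le_trans (ltW k0)).
  have y0 : 0 <= y by case/andP: yk => /(le_trans (ltW k0)).
  by rewrite (max_idPl x0) (max_idPl y0); exact: hc.
have mU : measurable ([set 0 : R] `|` \bigcup_k (I k `&` hpsi @^-1` A)).
  apply: measurableU => //; apply: bigcup_measurable => k _; exact: mI.
apply: (@subset_measure0 _ _ _ lam _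
  ([set 0] `|` \bigcup_k (I k `&` hpsi @^-1` A))) => //.
- by apply: measurableI; [exact: measurable_itv|exact: measurable_preimageT].
- move=> x [] /=; rewrite in_itv/= andbT le_eqVlt => /predU1P[<-|x0] xA.
    by left.
  right; exists (Num.trunc (Num.max x x^-1)) => //; split => //.
  rewrite /I /= in_itv/=.
  have := truncnS_gt (Num.max x x^-1); rewrite gt_max => /andP[x1 x2].
  rewrite (ltW x1) andbT invf_ple ?posrE// ltW//.
- apply/negligibleP => //.
  apply: negligibleU; first by apply/negligibleP => //; exact: lebesgue_measure_set1.
  by apply: negligible_bigcup => k; apply/negligibleP; [exact: mI|exact: I0].
Qed.

(** In the coordinates T, almost every simplex, for the radial law, is filled
    by the set that carries the copula, and almost every one, for Lebesgue
    measure, meets it in a null set. No simplex does both. *)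
Lemma radial_law_singular (e : R) (N : set (n.+1.-tuple R)) : 0 < e ->
  measurable N -> P (~` N) = 0%E -> lamt n.+1 N = 0%E ->
  exists M : set R, [/\ measurable M, lam M = 0%E
    & radial_law e [set r | n%:R * e < r /\ ~ M r] = 0%E].
Proof.
move=> e0 mN PN N0; pose s0 := n%:R * e.
have mh : measurable_fun setT hpsi := measurable_survival sF.
pose A := [set t : n.+1.-tuple R |
  (forall i, `[0, +oo[%classic (tnth t i)) /\ N (map_tuple hpsi t)].
have mA : measurable A.
  apply: measurableI.
    exact: (measurable_forall_tnth (A := fun=> `[0, +oo[%classic)).
  by apply: measurable_preimageT => //; exact: measurable_fun_map_tuple.
have A0 : lamt n.+1 A = 0%E.
  by apply: lebesgue_tuple0_map => //; exact: lebesgue_measure0_generator.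
pose E := [set t : n.+1.-tuple R |
  (upper_box (fun=> 0) t /\ s0 < tsum t) /\ ~ N (map_tuple hpsi t)].
have mE : measurable E.
  apply: measurableI; first apply: measurableI.
  - exact: measurable_upper_box.
  - rewrite (_ : (fun t => _) = [set t : n.+1.-tuple R |
        `]s0, +oo[%classic (tsum t)]); last first.
      by apply/seteqP; split => x; rewrite /= in_itv/= andbT.
    apply: (measurable_preimageT (f := @tsum R n.+1)) => //.
    exact: (measurable_fun_tsum (g := id)).
  - apply: (measurable_preimageT (A := ~` N)); last exact: measurableC.
    exact: measurable_fun_map_tuple.
have muE : mu E = 0%E.
  rewrite /mu /coordinates_law lawE.
  apply: (@subset_measure0 _ _ _ P _ (~` N)) => //.
  - apply: measurable_preimageT => //; exact: measurable_fun_map_tuple.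
  - exact: measurableC.
  move=> x [[Gx0 _] xN]; apply: contra_not xN => xN.
  suff -> : map_tuple hpsi (map_tuple G x) = x by [].
  apply: eq_from_tnth => i; rewrite !tnth_map.
  have := Gx0 i; rewrite tnth_map /hpsi => Gi0; rewrite (max_idPl Gi0).
  have [_ _ _ pF _] := sF.
  move: Gi0; rewrite inverse_ge// => /andP[xi0 xi1].
  have [_ GE _] := GP; apply: (GE _ _).2; rewrite xi0/=.
  by have [_ F0 _ _ _] := sF; rewrite -F0.
pose slice (B : set (n.+1.-tuple R)) : set (R * n.-tuple R) :=
  [set p | B (tcons (p.1 - tsum p.2) p.2)].
have mslice B : measurable B -> measurable (slice B).
  move=> mB; apply: (measurable_preimageT (f := fun p : R * n.-tuple R =>
    tcons (p.1 - tsum p.2) p.2)) => //.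
  apply: measurable_fun_tcons => //; apply: measurable_funB => //.
  exact: measurable_fun_tsum.
pose vE r := lamt n [set t | slice E (r, t)].
pose vA r := lamt n [set t | slice A (r, t)].
have mvE : measurable_fun setT vE := measurable_sectionl (lamt n) (mslice _ mE).
have mvA : measurable_fun setT vA := measurable_sectionl (lamt n) (mslice _ mA).
have gvE : radial_law e [set r | vE r != 0%E] = 0%E.
  apply/(ge0_integral_eq0P _ mvE); first by move=> r; exact: measure_ge0.
  rewrite -product_sectionsl.
  have <- := radial_decomposition coordinates_law_upper_box e0 mE.
  - by rewrite -/mu muE mule0.
  - by move=> t [[]].
  - by move=> t [[]].
have lvA : lam [set r | vA r != 0%E] = 0%E.
  apply: (proj1 (@ge0_integral_eq0P _ (measurableTypeR R) R lam vA mvA _)).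
    by move=> r; exact: measure_ge0.
  rewrite -(product_sectionsl lam (lamt n) (slice A)).
  rewrite (product_sectionsr lam (lamt n) (mslice _ mA)) -A0 lebesgue_tupleSr//.
  apply: eq_integral => t _.
  rewrite -[RHS](lebesgue_measure_translate (- tsum t)); last first.
    exact: measurable_tcons_head.
  by congr (lam _); apply/seteqP; split => r; rewrite /slice/= addrC.
have ms : measurable [set r | s0 < r].
  rewrite (_ : [set r | _] = `]s0, +oo[%classic); first exact: measurable_itv.
  by apply/seteqP; split => r; rewrite /= in_itv/= andbT.
pose M := [set r | s0 < r] `&` [set r | vE r = 0%E].
have mM : measurable M.
  apply: measurableI => //.
  rewrite (_ : [set r | _] = ~` [set r | vE r != 0%E]); last first.
    by apply/seteqP; split => r /= => [->|/negP]; rewrite ?eqxx// negbK => /eqP.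
  by apply: measurableC; exact: measurable_neq0.
exists M; split => //.
- apply: (@subset_measure0 _ _ _ lam _ [set r | vA r != 0%E]) => //.
  + exact: measurable_neq0.
  move=> r [sr Er]; apply/negP => /eqP Ar.
  have r0 : 0 < r by apply: le_lt_trans sr; rewrite mulr_ge0// ltW.
  have := simplex_volume_gt0 n r0; rewrite ltNge => /negP; apply.
  have mEr : measurable [set t | slice E (r, t)].
    by have := measurable_xsection r (mslice _ mE); rewrite xsectionE.
  have mAr : measurable [set t | slice A (r, t)].
    by have := measurable_xsection r (mslice _ mA); rewrite xsectionE.
  rewrite -[leRHS]adde0 -{1}Er -Ar; apply: le_trans (measureU2 _ mEr mAr).
  apply: le_measure; rewrite ?inE; first exact: measurable_simplex.
    exact: measurableU.
  move=> t [t0 ts].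
  have T0 : upper_box (fun=> 0) (tcons (r - tsum t) t).
    apply/(forall_tcons _ _ (fun=> (fun x => 0 <= x))).
    by split => //; rewrite subr_ge0.
  have [NT|NT] := pselect (N (map_tuple hpsi (tcons (r - tsum t) t))).
    right; split => // i; have := T0 i.
    by rewrite /= in_itv/= andbT.
  by left; split => //; split => //; rewrite tsum_cons subrK.
- apply: (@subset_measure0 _ _ _ (radial_law e) _ [set r | vE r != 0%E]) => //.
  + by apply: measurableI => //; exact: measurableC.
  + exact: measurable_neq0.
  by move=> r [sr] nM; apply/negP => /eqP Er; apply: nM.
Qed.

End archimedean_radial.

(** * The conditional law *)

Section conditional_measure.
Context {R : realType}.
Notation lam := (@lebesgue_measure R).
Notation lamt := (lebesgue_tuple R).
Variables (gam : probability R R) (n : nat) (s0 : R).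
Hypothesis fin_n : forall z, s0 < z -> (williamson gam n z < +oo)%E.
Hypothesis pos_n : forall z, s0 < z -> (0 < williamson gam n z)%E.
Hypothesis cvg_n : williamsonr gam n z @[z --> +oo] --> 0.
Variables (m : nat) (s : R).
Hypotheses (m0 : (0 < m <= n)%N) (ss : s0 < s).

Let mn : (m <= n)%N. Proof. by case/andP: m0. Qed.

Let w := williamsonr gam m s.

Let w0 : 0 < w.
Proof. exact: (williamsonr_gt0 fin_n pos_n). Qed.

Definition conditional_survival (y : R) : R := williamsonr gam m (s + y) / w.

Let F := conditional_survival.

Let sy y : 0 <= y -> s0 < s + y.
Proof. by move=> y0; rewrite (lt_le_trans ss)// lerDl. Qed.

Lemma conditional_survival_fun : survival_fun F.
Proof.
split.
- apply: continuous_in_subspaceT => y; rewrite inE/= in_itv/= andbT => y0.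
  apply: cvgM; last exact: cvg_cst.
  apply: (@continuous_comp _ _ _ (fun y => s + y) (williamsonr gam m)).
    by apply: cvgD; [exact: cvg_cst|exact: cvg_id].
  by apply: (williamsonr_continuous fin_n pos_n m0); exact: sy.
- by rewrite /F /conditional_survival addr0 divff// gt_eqF.
- move=> a b a0 ab; rewrite /F /conditional_survival ltr_pM2r ?invr_gt0//.
  by apply: (williamsonr_decreasing fin_n pos_n m0); [exact: sy|rewrite ltrD2l].
- move=> a a0; rewrite divr_gt0//; apply: (williamsonr_gt0 fin_n pos_n) => //.
  exact: sy.
- rewrite -[X in _ --> X](mul0r w^-1); apply: cvgM; last exact: cvg_cst.
  apply: (@cvg_comp _ _ _ (fun y => s + y) (williamsonr gam m) _ +oo%R).
    exact: cvg_addrl.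
  exact: (williamsonr_cvg0 fin_n pos_n).
Qed.

Variable H : R -> R.
Hypothesis HP : survival_inverse F H.

Let sF := conditional_survival_fun.
Let mH : measurable_fun setT H. Proof. by case: HP. Qed.
Let HK a : 0 <= a -> H (F a) = a.
Proof. exact: (survival_inverseK sF HP). Qed.

Let Fext x := F (Num.max x 0).
Let mFext : measurable_fun setT Fext := measurable_survival sF.
Let FextE x : 0 <= x -> Fext x = F x.
Proof. by move=> x0; rewrite /Fext (max_idPl x0). Qed.

Let D : set (R * m.-tuple R) := [set p | simplex m (p.1 - s) p.2].

Let mD : measurable D.
Proof.
apply: (measurable_simplex_preimage (f := fun p : R * m.-tuple R => p.1 - s)
  (g := snd)) => //.
exact: measurable_funB.
Qed.

(* the last coordinates of a vector of radius r whose first coordinates add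
   up to s, given the tail t of these last coordinates *)
Let remaining (p : R * m.-tuple R) : m.+1.-tuple R :=
  tcons (p.1 - s - tsum p.2) p.2.

Let quantiles (p : R * m.-tuple R) : m.+1.-tuple R :=
  map_tuple Fext (remaining p).

Let mquantiles : measurable_fun setT quantiles.
Proof.
have mr : measurable_fun setT remaining.
  apply: measurable_fun_tcons => //; apply: measurable_funB.
    exact: measurable_funB.
  exact: measurable_fun_tsum.
apply: (@measurableT_comp _ _ _ _ _ _ (map_tuple Fext)) => //.
exact: measurable_fun_map_tuple.
Qed.

Let base : probability (R * m.-tuple R)%type R :=
  mnormalize (mrestr (gam \x lamt m)%E mD) (dirac point).

(** The law of the remaining coordinates is the radial law times Lebesgue
    measure on [D], normalized; the default [dirac point] is never taken, the
    mass of [D] being positive and finite. *)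
Definition conditional_law : probability (m.+1.-tuple R) R :=
  law base mquantiles.

Let Q := conditional_law.

Let remaining_ge0 p i : D p -> 0 <= tnth (remaining p) i.
Proof.
move=> [t0 ts]; move: i.
apply/(forall_tcons _ _ (fun=> (fun x => 0 <= x))); split => //; lra.
Qed.

Let quantiles_itv p i : D p -> 0 < tnth (quantiles p) i <= 1.
Proof.
move=> Dp; rewrite tnth_map FextE ?remaining_ge0//.
by apply: (survival_itv sF); exact: remaining_ge0.
Qed.

Let tsum_remaining p : tsum (remaining p) = p.1 - s.
Proof. by rewrite tsum_cons subrK. Qed.

Lemma conditional_lawE A :
  Q A = ((gam \x lamt m) [set p | D p /\ A (quantiles p)] * (w^-1)%:E)%E.
Proof.
have DE : (gam \x lamt m)%E D = w%:E.
  transitivity (williamson gam m (s + \sum_(i < m) 0)).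
    by rewrite -williamson_upper_box.
  by rewrite big1// addr0 (williamsonrE fin_n mn ss).
rewrite /Q /conditional_law lawE /base/= /mnormalize/= /mrestr setTI DE.
rewrite eqe gt_eqF//=; congr (_ * _)%E; congr (product_measure1 _ _ _).
by apply/seteqP; split => p [].
Qed.

(** Every set whose trace on (0, 1]^{m+1} is a lower box has the measure of that
    box: unit cube, margins and lower boxes are all of this kind. *)
Lemma conditional_law_box (b : 'I_m.+1 -> R) (A : set (m.+1.-tuple R)) :
  (forall i, 0 <= b i) ->
  (forall v : m.+1.-tuple R, (forall i, 0 < tnth v i <= 1) ->
     A v <-> forall i, tnth v i <= F (b i)) ->
  Q A = (F (\sum_i b i))%:E.
Proof.
move=> b0 AE; rewrite conditional_lawE.
rewrite (_ : [set p | _] = [set p : R * m.-tuple R |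
    upper_box (b \o lift ord0) p.2 /\ tsum p.2 <= p.1 - (s + b ord0)]).
  rewrite williamson_upper_box -addrA -big_ord_recl.
  by rewrite (williamsonrE fin_n mn)// sy// sumr_ge0.
have qE p : D p -> A (quantiles p) <-> forall i, b i <= tnth (remaining p) i.
  move=> Dp; have := AE _ (fun i => quantiles_itv i Dp).
  move=> ->; split => h i; have := h i;
    by rewrite tnth_map FextE ?remaining_ge0// survival_le// remaining_ge0.
apply/seteqP; split => p.
  move=> [Dp /(qE _ Dp) /(forall_tcons _ _ (fun i x => b i <= x))[bp tp]].
  by split => //; lra.
move=> [tp rp]; have Dp : D p.
  split; first by move=> i; exact: (le_trans (b0 (lift ord0 i)) (tp i)).
  by have := b0 ord0; lra.
split => //; apply/(qE _ Dp)/(forall_tcons _ _ (fun i x => b i <= x)).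
by split => //; lra.
Qed.

Lemma conditional_law_unit_cube : Q (@unit_cube R m.+1) = 1%E.
Proof.
have [_ F0 _ _ _] := sF.
rewrite (conditional_law_box (b := fun=> 0))//; first by rewrite big1// F0.
move=> v v01; rewrite F0; split => h i; have /andP[/ltW v0 v1] := v01 i => //.
by rewrite v0.
Qed.

Lemma conditional_law_margin i u : 0 <= u <= 1 ->
  Q [set t | tnth t i <= u] = u%:E.
Proof.
move=> /andP[]; rewrite le_eqVlt => /predU1P[<- _|u0 u1].
  rewrite conditional_lawE (_ : [set p | _] = set0) ?measure0 ?mul0e//.
  apply/seteqP; split => // p [Dp] /=; have /andP[q0 _] := quantiles_itv i Dp.
  by rewrite leNgt q0.
have [_ F0 _ _ _] := sF.
have [_ HE _] := HP; have [Hu0 FHu] : 0 <= H u /\ F (H u) = u.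
  by apply: HE; rewrite u0.
rewrite (conditional_law_box (b := fun j => if j == i then H u else 0)).
- by rewrite -big_mkcond/= big_pred1_eq FHu.
- by move=> j; case: ifP.
- move=> v v01; split => /= [vi j|/(_ i)]; last by rewrite eqxx FHu.
  case: eqP => [->|_]; first by rewrite FHu.
  by rewrite F0; have /andP[] := v01 j.
Qed.

Lemma conditional_law_lower_box (u : m.+1.-tuple R) : unit_cube u ->
  (forall i, 0 < tnth u i) ->
  Q (lower_box u) = (F (\sum_i H (tnth u i)))%:E.
Proof.
move=> u01 u0; have [_ HE _] := HP.
have HuE i : 0 <= H (tnth u i) /\ F (H (tnth u i)) = tnth u i.
  by apply: HE; rewrite u0; have /andP[] := u01 i.
apply: conditional_law_box => [i|v v01]; first by have [] := HuE i.
split => h i.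
  by rewrite (HuE i).2; have /andP[] := h i.
by have /andP[/ltW -> _] := v01 i; have := h i; rewrite (HuE i).2.
Qed.

Lemma conditional_law_lower_box0 (u : m.+1.-tuple R) i : tnth u i = 0 ->
  Q (lower_box u) = 0%E.
Proof.
move=> ui; rewrite conditional_lawE (_ : [set p | _] = set0) ?measure0 ?mul0e//.
apply/seteqP; split => // p [Dp] /(_ i); rewrite ui => /andP[_].
by have /andP[q0 _] := quantiles_itv i Dp; rewrite leNgt q0.
Qed.

(** The sum of the remaining coordinates is [r - s], so the law is carried by
    the [u] for which [s] plus the sum of the [H u_i] lies in [M]. With the
    other coordinates fixed, the first one ranges over a preimage of [M] under
    an expanding map. *)
Lemma conditional_law_singular (M : set R) : measurable M -> lam M = 0%E ->
  gam [set r | s0 < r /\ ~ M r] = 0%E ->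
  mutually_singular Q (lamt m.+1).
Proof.
move=> mM M0 gM.
pose I : set R := `]0, 1]%classic.
pose N := [set v : m.+1.-tuple R | (forall i, I (tnth v i)) /\
  M (s + tsum (map_tuple H v))].
have mN : measurable N.
  apply: measurableI.
    apply: (measurable_forall_tnth (A := fun=> I)) => _; exact: measurable_itv.
  apply: (measurable_preimageT (f := fun v => s + tsum (map_tuple H v))) => //.
  apply: measurable_funD => //; apply: measurable_fun_tsum.
  exact: measurable_fun_map_tuple.
exists N; split => //.
- rewrite -[LHS]/(Q (~` N)) conditional_lawE.
  pose B : set (R * m.-tuple R) := [set r | s0 < r /\ ~ M r] `*` setT.
  have mB1 : measurable [set r | s0 < r /\ ~ M r].
    apply: measurableI; last exact: measurableC.
    rewrite (_ : (fun r => _) = `]s0, +oo[%classic); first exact: measurable_itv.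
    by apply/seteqP; split => r; rewrite /= in_itv/= andbT.
  have mB : measurable B by exact: measurableX.
  have B0 : (gam \x lamt m)%E B = 0%E.
    rewrite product_measure1E//.
    transitivity (0 * lamt m setT)%E; last exact: mul0e.
    by congr (_ * _)%E.
  rewrite (@subset_measure0 _ _ _ (gam \x lamt m)%E _ B) ?mul0e//.
    apply: measurableI => //.
    by apply: (measurable_preimageT (A := ~` N)) => //; exact: measurableC.
  move=> p [Dp Np]; split => //; have [t0 ts] := Dp; split.
    have t00 : 0 <= tsum p.2 by apply: sumr_ge0 => i _; exact: t0.
    by rewrite /= (lt_le_trans ss)// -subr_ge0 (le_trans t00).
  apply: contra_not Np => Mp; split.
    by move=> i; rewrite /I /= in_itv/=; exact: quantiles_itv.
  suff -> : map_tuple H (quantiles p) = remaining p.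
    by rewrite tsum_remaining addrC subrK.
  apply: eq_from_tnth => i; rewrite !tnth_map FextE ?remaining_ge0//.
  by rewrite HK// remaining_ge0.
- rewrite -[LHS]/(lamt m.+1 N) lebesgue_tupleSr//; apply: integral0_eq => t _.
  have [j mE jn] : exists2 j, m = j.+1 & (j < n)%N.
    by case: m m0 => // j /= jn; exists j.
  have wj : 0 < williamsonr gam j s.
    by apply: (williamsonr_gt0 fin_n pos_n) => //; exact: ltnW.
  pose h a := H a + (s + tsum (map_tuple H t)).
  have mh : measurable_fun setT h by exact: measurable_funD.
  have c0 : 0 < w / williamsonr gam j s by rewrite divr_gt0.
  have hexp a b : I a -> I b ->
      w / williamsonr gam j s * `|a - b| <= `|h a - h b|.
    have [_ HE _] := HP.
    rewrite /I /= !in_itv/= => /HE[Ha0 FHa] /HE[Hb0 FHb].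
    rewrite /h opprD addrACA subrr addr0 mulrAC ler_pdivrMr// [leRHS]mulrC.
    have sa : s <= s + H a by rewrite lerDl.
    have sb : s <= s + H b by rewrite lerDl.
    have := williamsonr_lipschitz fin_n pos_n jn ss sa sb.
    rewrite -mE opprD addrACA subrr add0r; apply: le_trans.
    rewrite -{1}FHa -{1}FHb /F /conditional_survival -mulrBl normrM mulrC.
    by rewrite (@gtr0_norm _ w^-1) ?invr_gt0// divfK// gt_eqF.
  have N0 := lebesgue_measure0_expanding c0 mh (measurable_itv _) mM hexp M0.
  apply: (@subset_measure0 _ _ _ lam _ (I `&` h @^-1` M)) => //.
  + exact: measurable_tcons_head.
  + apply: measurableI; first exact: measurable_itv.
    exact: measurable_preimageT.
  move=> a [/(forall_tcons _ _ (fun=> I))[Ia _]] Ma; split => //.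
  move: Ma; rewrite /h /=; congr M.
  rewrite (_ : map_tuple H (tcons a t) = tcons (H a) (map_tuple H t)).
    by rewrite tsum_cons; ring.
  by apply: eq_from_tnth => i; case: (unliftP ord0 i) => [k ->|->];
    rewrite tnth_map ?tnthS ?tnth0// tnth_map.
Qed.

End conditional_measure.

(** * The conditional copula *)

Section conditional_copula_formula.
Context {R : realType} (psi : R -> R) (l : nat) (x : l.-tuple R).
Variables (G : R -> R) (F H : R -> R) (s : R).
Hypotheses (gpsi : generator psi) (spsi : strict psi).
Hypothesis GP : survival_inverse psi G.
Hypotheses (sF : survival_fun F) (HP : survival_inverse F H).
Hypothesis sE : (\sum_(i < l) pseudoinverse psi (tnth x i))%E = s%:E.
Hypothesis FE : forall y, 0 <= y ->
  derive1n l psi (s + y) / derive1n l psi s = F y.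

Let kernel_marginal0 : kernel_marginal psi x 0 = 0.
Proof. by rewrite /kernel_marginal sE spsi addeC /= mul0r. Qed.

Let kernel_marginal_psi b : 0 <= b -> kernel_marginal psi x (psi b) = F b.
Proof.
by move=> b0; rewrite /kernel_marginal sE pseudoinverse_gen// -EFinD /= FE.
Qed.

Let psi_inverse y : 0 < y <= 1 -> exists2 b, 0 <= b & psi b = y.
Proof. by have [_ GE _] := GP => /GE[? ?]; exists (G y). Qed.

Let kernel_marginal_inj : set_inj `[0, 1]%classic (kernel_marginal psi x).
Proof.
have [_ _ _ pF _] := sF.
move=> y z /[!inE]; rewrite /= !in_itv/= => /andP[y0 y1] /andP[z0 z1].
move: y0 z0; rewrite !le_eqVlt => /predU1P[<-|y0] /predU1P[<-|z0] //.
- have [|b b0 <-] := @psi_inverse z; first by rewrite z0.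
  by rewrite kernel_marginal0 kernel_marginal_psi// => /eqP; rewrite lt_eqF// pF.
- have [|b b0 <-] := @psi_inverse y; first by rewrite y0.
  by rewrite kernel_marginal0 kernel_marginal_psi// => /eqP; rewrite gt_eqF// pF.
- have [|b b0 <-] := @psi_inverse z; first by rewrite z0.
  have [|a a0 <-] := @psi_inverse y; first by rewrite y0.
  by rewrite !kernel_marginal_psi// => /(survival_inj sF a0 b0) ->.
Qed.

Lemma kernel_quantile0 : kernel_quantile psi x 0 = 0.
Proof.
rewrite -{1}kernel_marginal0; apply: (pinvKV _ kernel_marginal_inj).
by rewrite inE /= in_itv/= lexx ler01.
Qed.

(** [g_x (psi b) = F b], so the inverse of [g_x] is [psi] composed with the
    inverse of [F]. *)
Lemma kernel_quantile_inverse u : 0 < u <= 1 ->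
  kernel_quantile psi x u = psi (H u).
Proof.
have [_ HE _] := HP => u01; have [Hu0 FHu] := HE _ u01.
rewrite -{1}FHu -kernel_marginal_psi//; apply: (pinvKV _ kernel_marginal_inj).
rewrite inE /= in_itv/=.
by have /andP[/ltW -> ->] := survival_itv (generator_survival gpsi spsi) Hu0.
Qed.

Lemma conditional_copulaE k (u : k.-tuple R) : unit_cube u ->
  (forall i, 0 < tnth u i) ->
  conditional_copula psi x u = F (\sum_i H (tnth u i)).
Proof.
move=> u01 u0; have [_ HE _] := HP.
have u01' i : 0 < tnth u i <= 1 by rewrite u0; have /andP[] := u01 i.
rewrite /conditional_copula /markov_kernel sE.
rewrite (eq_bigr (fun i => (H (tnth u i))%:E)) => [|i _].
  rewrite sumEFin -EFinD /= FE// sumr_ge0// => i _.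
  by have [] := HE _ (u01' i).
rewrite tnth_map kernel_quantile_inverse//.
by rewrite pseudoinverse_gen//; have [] := HE _ (u01' i).
Qed.

Lemma conditional_copula0 k (u : k.-tuple R) i : tnth u i = 0 ->
  conditional_copula psi x u = 0.
Proof.
move=> ui; rewrite /conditional_copula /markov_kernel sE.
have p0 y : (pseudoinverse psi y != -oo)%E.
  rewrite gt_eqF//; apply: (@lt_le_trans _ _ 0%E); first exact: ltNy0.
  by apply: le_ereal_inf_tmp => z [].
rewrite (bigD1 i)//= tnth_map ui kernel_quantile0 spsi.
rewrite addye; last first.
  by apply/eqP => /esum_eqNyP[j [_ _]] /eqP; exact/negP.
by rewrite addeC /= mul0r.
Qed.

End conditional_copula_formula.

Section conclusion.
Context {R : realType} (n : nat).
Variables (C : n.+1.-tuple R -> R) (psi : R -> R).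
Hypotheses (gpsi : generator psi) (spsi : strict psi).
Hypothesis CE : forall x, unit_cube x ->
  C x = ext0 psi (\sum_(i < n.+1) pseudoinverse psi (tnth x i))%E.
Hypothesis singC : singular_copula C.

(** Taking [e = s / 2n] puts the threshold [n e] at [s / 2], so that the
    representation of [psi] holds around every point of [[s, oo)]. *)
Lemma conditional_copula_singular l (x : l.-tuple R) k :
  (0 < l < n)%N -> k = (n - l).+1 -> open_unit_cube x ->
  singular_copula (fun u : k.-tuple R => conditional_copula psi x u).
Proof.
move=> /andP[l0 ln] -> x01.
have [P hP [N [mN PN N0]]] := singC.
have n0 : (0 < n)%N := ltn_trans l0 ln.
have sP := generator_survival gpsi spsi.
have [G GP] := survival_inverse_exists sP.
have Gx i : 0 < G (tnth x i).
  have /andP[x0 x1] := x01 i.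
  have [|Gi0 FGi] := (let: And3 _ GE _ := GP in GE) (tnth x i).
    by rewrite x0 ltW.
  rewrite lt_neqAle Gi0 andbT eq_sym; apply: contraTneq x1 => Gi.
  by have [_ F0 _ _ _] := sP; rewrite -FGi Gi F0 ltxx.
pose s := \sum_(i < l) G (tnth x i).
have sE : (\sum_(i < l) pseudoinverse psi (tnth x i))%E = s%:E.
  rewrite -sumEFin; apply: eq_bigr => i _; apply: pseudoinverseE => //.
  by have /andP[-> /ltW ->] := x01 i.
have s0 : 0 < s.
  rewrite /s (bigD1 (Ordinal l0))//= ltr_wpDr//.
  by apply: sumr_ge0 => i _; exact: ltW.
pose e := s / (n%:R * 2).
have nR : 0 < n%:R :> R by rewrite ltr0n.
have e0 : 0 < e by rewrite divr_gt0// mulr_gt0.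
have ss : n%:R * e < s.
  have -> : n%:R * e = s / 2 by rewrite /e; field; rewrite gt_eqF.
  by lra.
have [M [mM M0 gM]] := radial_law_singular hP gpsi spsi CE GP n0 e0 mN PN N0.
have fin := radial_law_fin hP gpsi spsi CE GP e0.
have pos := radial_law_pos hP gpsi spsi CE GP e0.
have psiE := generator_williamsonr hP gpsi spsi CE GP e0.
set gam := radial_law _ _ _ in gM fin pos psiE.
have en : e ^+ n != 0 by rewrite expf_neq0// gt_eqF.
have cvg0 : williamsonr gam n z @[z --> +oo] --> 0.
  have [_ _ _ _ psi0] := sP; rewrite -[X in _ --> X](mulr0 (e ^+ n)).
  apply: cvg_trans (cvgM (cvg_cst (e ^+ n)) psi0).
  apply: near_eq_cvg; exists (n%:R * e); split; first exact: num_real.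
  by move=> z sz; rewrite /= psiE// mulVKf.
pose m := (n - l)%N.
have m0 : (0 < m <= n)%N by rewrite subn_gt0 ln leq_subr.
have sF := conditional_survival_fun fin pos cvg0 m0 ss.
set F := conditional_survival _ _ _ in sF.
have [H HP] := survival_inverse_exists sF.
have FE y : 0 <= y -> derive1n l psi (s + y) / derive1n l psi s = F y.
  move=> y0; have sy : n%:R * e < s + y by rewrite (lt_le_trans ss)// lerDl.
  rewrite !(derive1n_williamsonr fin pos ln psiE)// invfM mulrACA divff ?mul1r//.
  by rewrite mulf_neq0 ?invr_neq0 ?signr_eq0.
exists (conditional_law fin pos cvg0 m0 ss); last first.
  exact: (conditional_law_singular fin pos cvg0 m0 ss HP mM M0 gM).
split.
- exact: (conditional_law_unit_cube fin pos cvg0 m0 ss).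
- move=> i u; exact: (conditional_law_margin fin pos cvg0 m0 ss HP).
move=> u u01; have [u0|/existsNP[i ui]] := pselect (forall i, 0 < tnth u i).
  rewrite (conditional_copulaE gpsi spsi GP sF HP sE FE)//.
  exact: (conditional_law_lower_box fin pos cvg0 m0 ss HP).
have {}ui : tnth u i = 0.
  apply/eqP; rewrite eq_le leNgt; move/negP: ui => -> /=.
  by have /andP[] := u01 i.
rewrite (conditional_copula0 gpsi spsi GP sF sE FE ui).
exact: (conditional_law_lower_box0 fin pos cvg0 m0 ss ui).
Qed.

End conclusion.

Theorem theorem6p9 (R : realType) (d : nat) (C : d.-tuple R -> R)
    (psi : R -> R) (hC : archimedean C psi) (hpsi : strict psi)
    (hsing : singular_copula C) (l : nat) (hl1 : (1 <= l)%N)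
    (hl2 : (l <= d - 2)%N) :
  exists Lambda : set (l.-tuple R),
    [/\ measurable Lambda, Lambda `<=` @open_unit_cube R l,
        lebesgue_tuple R l Lambda = 1%E
      & forall x, Lambda x ->
          singular_copula
            (fun u : (d - l).-tuple R => conditional_copula psi x u)].
Proof.
have [_ gpsi CE] := hC.
case: d C hC hsing hl2 CE => [|n] C hC hsing hl2 CE.
  by move: (leq_trans hl1 hl2).
have ln : (0 < l < n)%N by rewrite hl1; lia.
have openE : @open_unit_cube R l =
    [set t | forall i, `]0, 1[%classic (tnth t i)].
  by apply/seteqP; split => t h i; have := h i; rewrite /= in_itv.
exists (@open_unit_cube R l); split => //.
- rewrite openE; apply: (measurable_forall_tnth (A := fun=> `]0, 1[%classic)).
  by move=> i; exact: measurable_itv.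
- rewrite openE (lebesgue_tuple_box (A := fun=> `]0, 1[%classic)); last first.
    by move=> i; exact: measurable_itv.
  by rewrite big1// => i _; rewrite lebesgue_measure_itv/= lte_fin ltr01 sube0.
- move=> x x01; apply: (conditional_copula_singular gpsi hpsi CE hsing ln _ x01).
  by lia.
Qed.
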